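(* Let $k\in\mathbb{N}_0$ and $r\in[0,\infty)$ be such that $\max\{k,r\}>0$ and let $(x_n)_{n\in\mathbb{N}}$ be a sequence of real numbers converging to $x>0$, such that $(k+r)x_n\log n$ is an integer for all $n\in\mathbb{N}$. Then, as $n\to\infty$, we have the asymptotics $$\mathbb{P}\bigl[\mathrm{Lah}(n,k)_r=(k+r)x_n\log n\bigr]\sim\frac{n^{-(k+r)(x_n\log(x_n)-x_n+1)}}{\sqrt{2\pi(k+r)x\log n}}\,\frac{\Gamma(k+2r)}{\Gamma((k+r)x+r)};$$ if moreover $x>1$, then $$\mathbb{P}\bigl[\mathrm{Lah}(n,k)_r\geq(k+r)x_n\log n\bigr]\sim\frac{x}{x-1}\,\frac{n^{-(k+r)(x_n\log(x_n)-x_n+1)}}{\sqrt{2\pi(k+r)x\log n}}\,\frac{\Gamma(k+2r)}{\Gamma((k+r)x+r)};$$ and if moreover $x<1$, then $$\mathbb{P}\bigl[\mathrm{Lah}(n,k)_r\leq(k+r)x_n\log n\bigr]\sim\frac{1}{1-x}\,\frac{n^{-(k+r)(x_n\log(x_n)-x_n+1)}}{\sqrt{2\pi(k+r)x\log n}}\,\frac{\Gamma(k+2r)}{\Gamma((k+r)x+r)}.$$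
   Context: $\mathbb{N}=\{1,2,\ldots\}$, $\mathbb{N}_0=\mathbb{N}\cup\{0\}$. Let $\genfrac{[}{]}{0pt}{}{n}{k}$ and $\genfrac{\{}{\}}{0pt}{}{n}{k}$ be the (unsigned) Stirling numbers of the first kind (number of permutations of $\{1,\dots,n\}$ with exactly $k$ cycles) and of the second kind (number of partitions of $\{1,\dots,n\}$ into $k$ non-empty subsets). For $n\in\mathbb{N}_0$, $k\in\{0,\ldots,n\}$ and $r\in\mathbb{R}$ the $r$-Stirling numbers are defined (with $0^0=1$) by $$\genfrac{[}{]}{0pt}{}{n}{k}_r=\sum_{j=k}^n\genfrac{[}{]}{0pt}{}{n}{j}\binom{j}{k}r^{j-k},\qquad \genfrac{\{}{\}}{0pt}{}{n}{k}_r=\sum_{j=k}^n\binom{n}{j}\genfrac{\{}{\}}{0pt}{}{j}{k}r^{n-j}.$$ The $r$-Lah number is $L(n,k)_r=\sum_{j=k}^n\genfrac{[}{]}{0pt}{}{n}{j}_r\genfrac{\{}{\}}{0pt}{}{j}{k}_r$. For $n\in\mathbb{N}$, $k\in\{0,\ldots,n\}$, $r\in[0,\infty)$ with $\max\{k,r\}>0$, $\mathrm{Lah}(n,k)_r$ denotes a random variable with the $r$-Lah distribution $$\mathbb{P}[\mathrm{Lah}(n,k)_r=j]=\frac{1}{L(n,k)_r}\genfrac{[}{]}{0pt}{}{n}{j}_r\genfrac{\{}{\}}{0pt}{}{j}{k}_r,\qquad j\in\{k,k+1,\ldots,n\}.$$ $\Gamma$ is Euler's Gamma function; $a_n\sim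 b_n$ means $a_n/b_n\to1$ as $n\to\infty$. *)

(* Defs.v *)
From mathcomp Require Import all_boot all_order all_algebra perm.
From mathcomp Require Import all_classical all_reals all_analysis.
Import Order.TTheory GRing.Theory Num.Theory.
Import numFieldNormedType.Exports.

Set Implicit Arguments.
Unset Strict Implicit.
Unset Printing Implicit Defensive.

Local Open Scope classical_set_scope.
Local Open Scope ring_scope.

Definition stirling1 (n k : nat) : nat :=
  #|[set s : 'S_n | #|porbits s| == k]%SET|.

Definition stirling2 (n k : nat) : nat :=
  #|[set Q : {set {set 'I_n}} | finset.partition Q [set: 'I_n]%SET & #|Q| == k]%SET|.

Definition rstirling1 (R : realType) (n k : nat) (r : R) : R :=
  \sum_(k <= j < n.+1) (stirling1 n j)%:R * 'C(j, k)%:R * r ^+ (j - k).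

Definition rstirling2 (R : realType) (n k : nat) (r : R) : R :=
  \sum_(k <= j < n.+1) 'C(n, j)%:R * (stirling2 j k)%:R * r ^+ (n - j).

Definition rlah (R : realType) (n k : nat) (r : R) : R :=
  \sum_(k <= j < n.+1) rstirling1 n j r * rstirling2 j k r.

Definition rLah_distributed (R : realType) (d : measure_display)
    (T : measurableType d) (P : probability T R) (n k : nat) (r : R)
    (X : {RV P >-> R}) : Prop :=
  forall j : nat, (k <= j <= n)%N ->
    P [set w | X w = j%:R]
    = ((rlah n k r)^-1 * (rstirling1 n j r * rstirling2 j k r))%:E.

(* Euler's integral; it is only meaningful for [0 < z]. *)
Definition Gamma (R : realType) (z : R) : R :=
  \int[lebesgue_measure]_(t in `]0, +oo[) (t `^ (z - 1) * expR (- t)).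

Definition asymp_equiv (R : realType) (a b : nat -> R) : Prop :=
  (fun n => a n / b n) @ \oo --> (1 : R).

(* Main.v *)
Require Import Defs.
From mathcomp Require Import all_boot all_order all_algebra fingroup perm.
From mathcomp Require Import all_classical all_reals all_analysis.
From mathcomp Require Import measurable_realfun.
From mathcomp Require Import ring lra zify.
Import Order.TTheory GRing.Theory Num.Theory.
Import numFieldNormedType.Exports.

Set Implicit Arguments.
Unset Strict Implicit.
Unset Printing Implicit Defensive.

Local Open Scope classical_set_scope.
Local Open Scope ring_scope.

(** Write [c = k + r] and [L = ln n].  The numbers [[n, j]_r] are the
coefficients of [prod_(i < n) (v + r + i)], and [k! {j, k}_r] lies between
[c^j - k (c - 1)^j] and [c^j]; hence [k! L(n, k)_r] is asymptotic to
[prod_(i < n) (c + r + i)], which Gauss's product formula evaluates as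
[n! n^(c + r - 1) / Gamma (c + r)].

For the numerator, factor [prod_(i < n) (v + r + i) = n! n^(r - 1) e^(L v) H_n(v)].
By Gauss's formula [H_n(v)] tends to [1 / Gamma (v + r)], and the Weierstrass
factors [(1 + w / i) e^(- w / i) = 1 + O(1 / i^2)] bound the power series of
[H_n] in every weighted l^1 norm, uniformly in [n].  Extracting the coefficient
of [v^j] with [j = y L] therefore replaces [v] by [y] in [H_n] and leaves the
Poisson weight [L^j / j!], which Stirling's formula evaluates.

The sequence [j |-> [n, j]_r] is log-concave, so the terms of both tails are
dominated by geometric sequences whose ratios converge to [1 / x], resp. [x]. *)

(** * Stirling numbers *)

(** The difficulty is that the index [j] grows with [n], so convergence of each fixed coefficient of
    [H_n] is not enough; the weighted l^1 bound is what allows passing to the limit under the sum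
    over all coefficients. The Gamma function appears twice for the same reason: the rising product
    is taken at [v = c] for the normalising sum, which gives [Gamma (c + r) = Gamma (k + 2 r)], and
    at [v = c x] for the coefficient. The power of [n] comes from the Poisson weight [c^j L^j / j!]
    divided by [n^c]. Stirling's formula is applied at the exact index [j = c x_n L], so [x_n] stays
    in the exponent, where an error [o(1)] would be multiplied by [L]; elsewhere its limit [x]
    suffices. Log-concavity is used for the first-kind numbers only: the second-kind ones are at
    most [c^j / k!] and asymptotic to it, which already gives a domination with constant tending to
    [1]. *)

Lemma porbit_lift_perm n (s : 'S_n) (i : 'I_n) :
  porbit (lift_perm ord0 ord0 s) (lift ord0 i) = [set lift ord0 j | j in porbit s i]%SET.
Proof.
have E m j : ((lift_perm ord0 ord0 s) ^+ m)%g (lift ord0 j) = lift ord0 ((s ^+ m)%g j).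
  elim: m j => [|m IH] j; first by rewrite !expg0 !perm1.
  by rewrite !expgSr !permM IH lift_perm_lift.
apply/setP => y; apply/porbitP/imsetP => [[m ->]|[j /porbitP[m ->] ->]].
  by rewrite E; exists ((s ^+ m)%g i) => //; rewrite mem_porbit.
by exists m; rewrite E.
Qed.

Lemma porbit_lift_perm0 n (s : 'S_n) :
  porbit (lift_perm ord0 ord0 s) ord0 = [set ord0]%SET.
Proof.
apply/setP => y; rewrite inE; apply/porbitP/eqP => [[m ->]|->]; last first.
  by exists 0%N; rewrite expg0 perm1.
elim: m => [|m IH]; first by rewrite expg0 perm1.
by rewrite expgSr permM IH lift_perm_id.
Qed.

Lemma card_porbits_lift_perm n (s : 'S_n) :
  #|porbits (lift_perm ord0 ord0 s)| = #|porbits s|.+1.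
Proof.
set t := lift_perm _ _ _.
have -> : porbits t = ([set ord0]%SET |: [set lift ord0 @: (B : {set 'I_n}) | B in porbits s])%SET.
  apply/setP => B; rewrite !inE; apply/imsetP/orP.
    move=> [y _ ->]; case: (unliftP ord0 y) => [i ->|->].
      right; apply/imsetP; exists (porbit s i); first exact: imset_f.
      exact: porbit_lift_perm.
    by left; rewrite porbit_lift_perm0.
  case=> [/eqP->|/imsetP[C /imsetP[i _ ->] ->]].
    by exists ord0 => //; rewrite porbit_lift_perm0.
  by exists (lift ord0 i) => //; rewrite porbit_lift_perm.
rewrite cardsU1 card_imset ?add1n; last exact/imset_inj/lift_inj.
case: imsetP => // -[C _ /setP /(_ ord0)]; rewrite !inE eqxx.
by move=> /esym/imsetP[j _ /eqP]; rewrite (negbTE (neq_lift _ _)).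
Qed.

(** A transposition of two points in different cycles merges these cycles, so the cycle formed by
    the fixed point [ord0] is absorbed again. *)
Lemma card_porbits_tperm_lift n (s : 'S_n) (i : 'I_n.+1) : i != ord0 ->
  #|porbits (tperm ord0 i * lift_perm ord0 ord0 s)%g| = #|porbits s|.
Proof.
move=> i0; have := porbits_mul_tperm (lift_perm ord0 ord0 s) ord0 i.
rewrite /= porbit_sym porbit_lift_perm0 inE i0 eq_sym i0 card_porbits_lift_perm.
by move=> /eqP; rewrite addn1 addn2 !eqSS => /eqP.
Qed.

(** The index [i] is recovered as the preimage of [ord0], and equality of cardinals does the rest.
    The choice [i = ord0] adds a cycle and the [n] others do not, whence the factor [x + n] of the
    rising factorial. *)
Lemma perm_ordS_decomp n :
  bijective (fun p : 'I_n.+1 * 'S_n => (tperm ord0 p.1 * lift_perm ord0 ord0 p.2)%g).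
Proof.
apply: inj_card_bij; last first.
  by rewrite card_prod !card_ord !card_Sn factS.
move=> [i s] [j t] /= E.
have /eqP := congr1 (fun u : 'S_n.+1 => (u^-1)%g ord0) E.
rewrite !invMg !permM !lift_permV !lift_perm_id !tpermV !tpermL => /eqP ij; subst j.
congr pair; have {}E := mulgI _ _ _ E.
apply/permP => k; apply: (@lift_inj _ ord0).
by rewrite -!(lift_perm_lift ord0) E.
Qed.

Lemma sum_expr_card_porbits (R : comNzRingType) (x : R) n :
  \sum_(s : 'S_n) x ^+ #|porbits s| = \prod_(i < n) (x + i%:R).
Proof.
elim: n => [|n IH].
  rewrite big_ord0 (big_pred1 1%g) => [|s]; last first.
    by apply/esym/eqP/permP => -[].
  suff -> : porbits (1%g : 'S_0) = finset.set0 by rewrite cards0 expr0.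
  by apply/setP => B; rewrite inE; apply/imsetP => -[[]].
rewrite big_ord_recr /= -IH (reindex _ (onW_bij _ (perm_ordS_decomp n))) /=.
rewrite -(pair_bigA _ (fun i s => x ^+ #|porbits (tperm ord0 i * lift_perm ord0 ord0 s)%g|)) /=.
rewrite big_ord_recl /= mulrDr; congr (_ + _).
  rewrite mulr_suml; apply: eq_bigr => s _.
  by rewrite tperm1 mul1g card_porbits_lift_perm exprSr.
rewrite -[X in _ = _ * X%:R]card_ord mulr_natr -sumr_const; apply: eq_bigr => i _.
apply: eq_bigr => s _.
by rewrite card_porbits_tperm_lift // eq_sym neq_lift.
Qed.

Lemma card_porbits_le n (s : 'S_n) : (#|porbits s| <= n)%N.
Proof. by rewrite -[X in (_ <= X)%N]card_ord; exact: leq_imset_card. Qed.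

Lemma sum_stirling1 (R : comNzRingType) (x : R) n :
  \sum_(j < n.+1) (stirling1 n j)%:R * x ^+ j = \prod_(i < n) (x + i%:R).
Proof.
rewrite -sum_expr_card_porbits.
rewrite (partition_big (fun s => inord #|porbits s| : 'I_n.+1) xpredT) //=.
apply: eq_bigr => j _.
rewrite /stirling1 -sum1dep_card natr_sum mulr_suml.
apply: eq_big => s.
  by rewrite -val_eqE /= inordK // ltnS card_porbits_le.
by move=> /eqP ->; rewrite mul1r.
Qed.

Definition rising (R : nzRingType) (n : nat) (r : R) : {poly R} :=
  \prod_(i < n) ('X + (r + i%:R)%:P).

Lemma coef_XaddCn (R : comNzRingType) (r : R) n k :
  (('X + r%:P) ^+ n)`_k = 'C(n, k)%:R * r ^+ (n - k).
Proof.
rewrite addrC exprDn coef_sum.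
under eq_bigr => i _ do rewrite -polyC_exp coefMn coefCM coefXn.
case: (leqP k n) => kn.
  rewrite (bigD1 (Ordinal (kn : (k < n.+1)%N))) //= eqxx mulr1 big1 ?addr0.
    by rewrite mulr_natl.
  move=> i; rewrite -val_eqE /= eq_sym => /negbTE ->.
  by rewrite mulr0 mul0rn.
rewrite bin_small // mul0r big1 // => i _.
have -> : (k == i) = false by apply/eqP; have := ltn_ord i; lia.
by rewrite mulr0 mul0rn.
Qed.

(** The binomial sum defining the r-Stirling numbers is the effect of substituting ['X + r] for the
    variable in [sum_stirling1]. *)
Lemma rstirling1E (R : realType) n k (r : R) : rstirling1 n k r = (rising n r)`_k.
Proof.
have -> : rising n r = \sum_(j < n.+1) (stirling1 n j)%:R * ('X + r%:P) ^+ j.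
  rewrite sum_stirling1; apply: eq_bigr => i _.
  by rewrite polyCD addrA polyC_natr.
rewrite coef_sum /rstirling1.
have E j : ((stirling1 n j)%:R * ('X + r%:P) ^+ j)`_k =
   (stirling1 n j)%:R * 'C(j, k)%:R * r ^+ (j - k).
  by rewrite mulr_natl coefMn coef_XaddCn -[LHS]mulr_natl mulrA.
under [RHS]eq_bigr => j _ do rewrite E.
rewrite -(big_mkord xpredT (fun j => (stirling1 n j)%:R * 'C(j, k)%:R * r ^+ (j - k))).
case: (leqP k n.+1) => kn; last first.
  rewrite (big_geq (ltnW kn)) big_nat big1 // => j /andP[_ jn].
  by rewrite bin_small ?mulr0 ?mul0r //; apply: leq_trans jn (ltnW kn).
rewrite [RHS](big_cat_nat _ kn) //= [X in _ = X + _]big_nat [X in _ = X + _]big1 ?add0r // => j /andP[_ jk].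
by rewrite bin_small ?mulr0 ?mul0r.
Qed.

(** * Stirling numbers of the second kind, by sorting functions according to their fibres *)

Lemma eq_preim_partition (T rT1 rT2 : finType) (f : T -> rT1) (g : T -> rT2) (D : {set T}) :
  (forall i j, (f i == f j) = (g i == g j)) ->
  preim_partition f D = preim_partition g D.
Proof.
move=> fg; apply: eq_imset => i; apply/setP => j.
by rewrite !inE fg.
Qed.

(** A function whose fibres are the blocks of [Q] amounts to an injective colouring of the
    blocks. *)
Lemma card_ffun_preim_partition (T : finType) x (Q : {set {set T}}) :
  finset.partition Q [set: T]%SET ->
  #|[set f : {ffun T -> 'I_x} | preim_partition f [set: T]%SET == Q]%SET| = x ^_ #|Q|.
Proof.
move=> PQ; have [/eqP cQ tQ _] := and3P PQ.
have inQ i : finset.pblock Q i \in Q by apply: finset.pblock_mem; rewrite cQ inE.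
pose K := {B : {set T} | B \in Q}.
pose b i : K := Sub (finset.pblock Q i) (inQ i).
have ne (B : K) : exists i, i \in val B.
  have [_ _ Q0] := and3P PQ.
  by apply/set0Pn; apply: contraNneq Q0 => <-; exact: (valP B).
have bK (B : K) i : i \in val B -> b i = B.
  by move=> iB; apply: val_inj => /=; apply: finset.def_pblock (valP B) iB.
pose phi (g : {ffun K -> 'I_x}) : {ffun T -> 'I_x} := [ffun i => g (b i)].
have phi_inj : injective phi.
  move=> g h gh; apply/ffunP => B; have [i iB] := ne B.
  by move/ffunP/(_ i): gh; rewrite !ffunE (bK _ _ iB).
have -> : #|Q| = #|{: K}| by rewrite card_sig; apply: eq_card.
rewrite -[X in X ^_ _]card_ord -card_inj_ffuns -(card_imset _ phi_inj).
apply: eq_card => f; rewrite inE; apply/eqP/imsetP => [fQ|[g]].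
  have E i j : (f i == f j) = (j \in finset.pblock Q i).
    rewrite -fQ /preim_partition finset.pblock_equivalence_partition //.
    by apply: in3W; split => // /eqP ->.
  (* The colour of a block is read off at a chosen representative. *)
  exists [ffun B => f (xchoose (ne B))].
    rewrite inE; apply/injectiveP => B C; rewrite !ffunE => /eqP.
    rewrite E => h; apply: val_inj => /=.
    have := xchooseP (ne B); have := xchooseP (ne C) => hC hB.
    move: h; rewrite (finset.def_pblock tQ (valP B) hB) => h.
    by rewrite -(finset.def_pblock tQ (valP B) h) (finset.def_pblock tQ (valP C) hC).
  apply/ffunP => i; rewrite !ffunE; apply/eqP; rewrite E.
  exact: (xchooseP (ne (b i))).
rewrite inE => /injectiveP ginj ->.
rewrite -[RHS](finset.preim_partition_pblock PQ); apply: eq_preim_partition => i j.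
by rewrite !ffunE (inj_eq ginj) -val_eqE.
Qed.

Lemma sum_stirling2 n x : (x ^ n = \sum_(m < n.+1) stirling2 n m * x ^_ m)%N.
Proof.
have -> : (x ^ n)%N = #|{: {ffun 'I_n -> 'I_x}}| by rewrite card_ffun !card_ord.
rewrite -sum1_card.
rewrite (partition_big (fun f : {ffun 'I_n -> 'I_x} => preim_partition f [set: 'I_n]%SET)
  (fun Q => finset.partition Q [set: 'I_n]%SET)) /=; last first.
  by move=> f _; exact: preim_partitionP.
under eq_bigr => Q PQ.
  rewrite sum1dep_card card_ffun_preim_partition //; over.
have cardQ (Q : {set {set 'I_n}}) : finset.partition Q [set: 'I_n]%SET -> (#|Q| <= n)%N.
  move=> PQ; rewrite -[X in (_ <= X)%N]card_ord -cardsT (finset.card_partition PQ) -sum1_card.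
  apply: leq_sum => B BQ; rewrite card_gt0; have [_ _ Q0] := and3P PQ.
  by apply: contraNneq Q0 => <-.
rewrite (partition_big (fun Q : {set {set 'I_n}} => inord #|Q| : 'I_n.+1) xpredT) //=.
apply: eq_bigr => m _.
rewrite /stirling2 -sum1dep_card big_distrl /=.
apply: eq_big => Q.
  by case PQ : (finset.partition Q _) => //=; rewrite -val_eqE /= inordK // ltnS cardQ.
by move=> /andP[PQ /eqP <-]; rewrite inordK ?mul1n // ltnS cardQ.
Qed.

Lemma stirling2_small n m : (n < m)%N -> stirling2 n m = 0%N.
Proof.
move=> nm; rewrite /stirling2; apply/eqP; rewrite cards_eq0; apply/eqP/setP => Q.
rewrite !inE; apply/negbTE/negP => /andP[PQ /eqP Qm].
suff : (#|Q| <= n)%N by lia.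
rewrite -[X in (_ <= X)%N]card_ord -cardsT (finset.card_partition PQ) -sum1_card.
apply: leq_sum => B BQ; rewrite card_gt0; have [_ _ Q0] := and3P PQ.
by apply: contraNneq Q0 => <-.
Qed.

Lemma sum_stirling2_le n x : (x ^ n = \sum_(m < x.+1) stirling2 n m * x ^_ m)%N.
Proof.
rewrite sum_stirling2 -!(big_mkord xpredT (fun m => stirling2 n m * x ^_ m)%N).
case: (leqP n x) => nx.
  rewrite [RHS](@big_cat_nat _ _ _ n.+1) //= [X in (_ = _ + X)%N]big_nat.
  rewrite [X in (_ = _ + X)%N]big1 ?addn0 // => m /andP[nm _].
  by rewrite stirling2_small.
rewrite (@big_cat_nat _ _ _ x.+1) //=; last exact: ltnW.
rewrite [X in (_ + X = _)%N]big_nat.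
rewrite [X in (_ + X = _)%N]big1 ?addn0 // => m /andP[nm _].
by rewrite ffact_small // muln0.
Qed.

(** The left side is the summand of index [k] in the expansion of [k ^ n] by falling factorials. *)
Lemma stirling2_upper n k : (k`! * stirling2 n k <= k ^ n)%N.
Proof.
rewrite sum_stirling2_le big_ord_recr /= ffactnn mulnC leq_addl //.
Qed.

(** Combinatorially, a function that is not surjective misses one of [k + 1] values. The proof
    compares expansions termwise, through [k.+1 ^_ m <= k.+1 * k ^_ m] for [m <= k]. *)
Lemma stirling2_lower n k : (k.+1 ^ n <= k.+1`! * stirling2 n k.+1 + k.+1 * k ^ n)%N.
Proof.
rewrite sum_stirling2_le big_ord_recr /= ffactnn mulnC addnC leq_add2l.
rewrite [in leqRHS]sum_stirling2_le big_distrr /=; apply: leq_sum => m _.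
rewrite mulnCA leq_mul2l; apply/orP; right.
case: m => -[|l] /= lk; first by rewrite !ffactn0 muln1.
by rewrite ffactSS leq_mul2l /= ffactnSr leq_pmulr // subn_gt0.
Qed.

Section rstirling2_bounds.
Variables (R : realType) (r : R).
Hypothesis r_ge0 : 0 <= r.

Lemma rstirling2E n k :
  rstirling2 n k r = \sum_(j < n.+1) 'C(n, j)%:R * (stirling2 j k)%:R * r ^+ (n - j).
Proof.
rewrite /rstirling2 -(big_mkord xpredT (fun j => 'C(n, j)%:R * (stirling2 j k)%:R * r ^+ (n - j))).
case: (leqP k n.+1) => kn; last first.
  rewrite (big_geq (ltnW kn)) big_nat big1 // => j /andP[_ jn].
  by rewrite stirling2_small ?mulr0 ?mul0r //; apply: leq_trans jn (ltnW kn).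
rewrite [RHS](big_cat_nat _ kn) //= [X in _ = X + _]big_nat [X in _ = X + _]big1 ?add0r // => j /andP[_ jk].
by rewrite stirling2_small ?mulr0 ?mul0r.
Qed.

(** The convolution that defines [rstirling2] turns [k ^ j] into [(k + r) ^ n], so the bounds for
    [stirling2] carry over term by term. *)
Lemma natr_add_exp n k :
  (k%:R + r) ^+ n = \sum_(j < n.+1) 'C(n, j)%:R * (k ^ j)%:R * r ^+ (n - j).
Proof.
rewrite addrC exprDn; apply: eq_bigr => j _.
by rewrite natrX -mulr_natl; ring.
Qed.

Lemma rstirling2_ge0 n k : 0 <= rstirling2 n k r.
Proof.
rewrite rstirling2E; apply: sumr_ge0 => j _.
by rewrite !mulr_ge0 // exprn_ge0.
Qed.

Lemma rstirling2_upper n k : k`!%:R * rstirling2 n k r <= (k%:R + r) ^+ n.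
Proof.
rewrite rstirling2E natr_add_exp mulr_sumr; apply: ler_sum => j _.
rewrite !mulrA ler_wpM2r ?exprn_ge0 // mulrAC mulrC ler_wpM2l //.
by rewrite -natrM ler_nat stirling2_upper.
Qed.

Lemma rstirling2_lower n k :
  (k.+1%:R + r) ^+ n - k.+1%:R * (k%:R + r) ^+ n <= k.+1`!%:R * rstirling2 n k.+1 r.
Proof.
rewrite lerBlDr rstirling2E !natr_add_exp !mulr_sumr -big_split /=; apply: ler_sum => j _.
rewrite !mulrA -mulrDl ler_wpM2r ?exprn_ge0 //.
rewrite ![_ * 'C(n, j)%:R]mulrC -!mulrA -mulrDr ler_wpM2l //.
by rewrite -!natrM -natrD ler_nat stirling2_lower.
Qed.

(** The lower bound above needs at least one block. With no block, only the term [j = 0] survives,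
    by the expansion of [0 ^ j]. *)
Lemma rstirling2_0 n : rstirling2 n 0 r = r ^+ n.
Proof.
rewrite rstirling2E big_ord_recl bin0 subn0 mul1r big1 ?addr0 => [|j _].
  have := sum_stirling2_le 0 0; rewrite big_ord_recl big_ord0 ffactn0 muln1 addn0 /=.
  by rewrite expn0 => <-; rewrite mul1r.
have := sum_stirling2_le (bump 0 j) 0; rewrite big_ord_recl big_ord0 ffactn0 muln1 addn0 /=.
by rewrite /bump leq0n add1n exp0n // => <-; rewrite mulr0 mul0r.
Qed.

End rstirling2_bounds.

(** * The Gamma function *)

Lemma eq_ler (R : realDomainType) (x y : R) : x = y -> x <= y.
Proof. by move=> ->. Qed.

Section Gamma_function.
Variable R : realType.
Implicit Types (z s t : R).
Notation mu := (@lebesgue_measure R).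

Lemma bigcup_itv_inv (u : nat -> R) : (forall n, n%:R + 1 <= u n) ->
  \bigcup_n `[(u n)^-1, u n]%classic = `]0, +oo[%classic :> set R.
Proof.
move=> un; have u0 n : 0 < u n by apply: lt_le_trans (un n); rewrite ltr_wpDl.
apply/seteqP; split => [t [n _] /=|t /=].
  rewrite !in_itv /= andbT => /andP[+ _]; apply: lt_le_trans.
  by rewrite invr_gt0.
rewrite in_itv /= andbT => t0.
pose m := Num.truncn (t + t^-1).
have tm : t + t^-1 < m%:R + 1.
  have /andP[_ h] : m%:R <= t + t^-1 < m.+1%:R.
    by apply: truncn_itv; rewrite addr_ge0 ?invr_ge0 // ltW.
  by rewrite natr1.
have h := lt_le_trans tm (un m).
have ti : 0 < t^-1 by rewrite invr_gt0.
exists m => //=; rewrite in_itv /=; apply/andP; split; last lra.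
rewrite -[leRHS]invrK lef_pV2 ?posrE //; lra.
Qed.

(** Monotone convergence along compact intervals that avoid both the singularity at [0] and
    infinity: integration by parts and substitution are done on them and then passed to the
    limit. *)
Lemma cvg_integral_itv_inv (f : R -> R) (u : nat -> R) :
  nondecreasing_seq u -> (forall n, n%:R + 1 <= u n) ->
  measurable_fun `](0 : R), +oo[ f -> (forall t, 0 < t -> 0 <= f t) ->
  (\int[mu]_(t in `[((u n)^-1)%R, u n]) (f t)%:E @[n --> \oo] -->
   \int[mu]_(t in `]0%R, +oo[) (f t)%:E)%E.
Proof.
move=> ndu un mf f0.
have u0 n : 0 < u n by apply: lt_le_trans (un n); rewrite ltr_wpDl.
have sub n : `[(u n)^-1, u n]%classic `<=` `]0, +oo[%classic.
  by rewrite -(bigcup_itv_inv un) => t ht; exists n.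
rewrite -(bigcup_itv_inv un); apply: ge0_nondecreasing_set_cvg_integral.
- move=> m n mn; rewrite subsetEset; apply: subset_itv; rewrite bnd_simp.
    by rewrite lef_pV2 ?posrE // ndu.
  exact: ndu.
- by move=> i; exact: measurable_itv.
- move=> i; apply/measurable_EFinP; apply: (measurable_funS _ (@sub i) mf).
  exact: measurable_itv.
- move=> i t /sub /=; rewrite in_itv /= andbT => t0.
  by rewrite lee_fin f0.
Qed.

(** Kept in the extended reals so that the functional equation and the convexity bound are available
    before finiteness, which is deduced from them. *)
Definition gammae z : \bar R :=
  (\int[mu]_(t in `]0%R, +oo[) (t `^ (z - 1) * expR (- t))%:E)%E.

Lemma measurable_gamma_integrand z D :
  measurable_fun D (fun t => t `^ (z - 1) * expR (- t)).
Proof.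
apply: measurable_funTS; apply: measurable_funM; first exact: measurable_powR.
by apply: measurableT_comp => //.
Qed.

Lemma continuous_powR_gt0 z t : 0 < t -> {for t, continuous (@powR R ^~ z)}.
Proof.
move=> t0; apply: differentiable_continuous; apply/derivable1_diffP.
by apply: derivable_powR; rewrite in_itv /= andbT.
Qed.

Lemma cvgn_gt0_Mry (u : nat -> R) z : 0 < z -> u n @[n --> \oo] --> +oo ->
  z * u n @[n --> \oo] --> +oo.
Proof.
move=> z0 uy; apply/cvgryPge => A; near=> n.
by rewrite mulrC -ler_pdivrMr //; near: n; exact: cvgry_ge.
Unshelve. all: by end_near. Qed.

Lemma cvgn_ln_pinfty (u : nat -> R) : u n @[n --> \oo] --> +oo ->
  ln (u n) @[n --> \oo] --> +oo.
Proof.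
move=> uy; apply/cvgryPge => A; near=> n.
have un : expR A <= u n by near: n; exact: (cvgry_ge uy (expR A)).
by rewrite -(expRK A) ler_ln ?posrE ?expR_gt0 // (lt_le_trans (expR_gt0 A)).
Unshelve. all: by end_near. Qed.

Lemma cvg_powRN (u : nat -> R) z : 0 < z -> u n @[n --> \oo] --> +oo ->
  (u n) `^ (- z) @[n --> \oo] --> 0.
Proof.
move=> z0 uy.
apply: (@cvg_trans _ (expR (- (z * ln (u n))) @[n --> \oo])).
  apply: near_eq_cvg; near=> n; have un : 0 < u n by near: n; exact: (cvgry_gt uy 0).
  by rewrite /powR gt_eqF // mulNr.
apply: (@cvg_comp _ _ _ (fun n => z * ln (u n)) (fun y => expR (- y)) _ +oo).
  exact/cvgn_gt0_Mry/cvgn_ln_pinfty.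
exact: cvgr_expR.
Unshelve. all: by end_near. Qed.

(** A single term of the exponential series, of degree above [z + 1], suffices; the spare power of
    [t] makes the upper boundary term of the integration by parts vanish. *)
Lemma powR_expRN_le z t : 0 <= z -> 1 <= t ->
  t `^ z * expR (- t) <= (Num.truncn z).+2`!%:R / t.
Proof.
move=> z0 t1; have t0 : 0 < t by lra.
set m := Num.truncn z; have zm : z < m.+1%:R.
  by have /andP[] := truncn_itv z0.
rewrite ler_pdivlMr // expRN mulrAC ler_pdivrMr ?expR_gt0 //.
have h := @expR_ge1Dxn R t m.+1 (ltW t0).
have h2 : t ^+ m.+2 <= m.+2`!%:R * expR t.
  have f0 : 0 < m.+2`!%:R :> R by rewrite ltr0n fact_gt0.
  rewrite mulrC -ler_pdivrMr //; apply: le_trans h; lra.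
apply: le_trans h2.
rewrite exprSr ler_wpM2r ?(ltW t0) // -powR_mulrn ?(ltW t0) //.
by rewrite ler_powR // ltW.
Qed.

Lemma gammae_rec z : 0 < z -> gammae (z + 1) = (z%:E * gammae z)%E.
Proof.
(* Starting at [2] keeps the interval from [(u n)^-1] to [u n] nondegenerate. *)
move=> z0; pose u n : R := n.+2%:R.
have ndu : nondecreasing_seq u by move=> m n mn; rewrite ler_nat !ltnS.
have un n : n%:R + 1 <= u n by rewrite natr1 ler_nat.
have u1 n : 1 < u n by rewrite ltr1n.
have u0 n : 0 < u n by apply: lt_trans (u1 n).
have uy : u n @[n --> \oo] --> +oo.
  by apply/cvgryPge => A; near=> n; rewrite (le_trans _ (un n))// ler_wpDr //; near: n;
  exact: nbhs_infty_ger.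
have cf1 := cvg_integral_itv_inv ndu un (@measurable_gamma_integrand (z + 1) _)
   (fun t _ => mulr_ge0 (powR_ge0 _ _) (expR_ge0 _)).
have cf0 := cvg_integral_itv_inv ndu un (@measurable_gamma_integrand z _)
   (fun t _ => mulr_ge0 (powR_ge0 _ _) (expR_ge0 _)).
(* The boundary term for the primitives [t ^ z] and [- e^(- t)]: it vanishes at the upper end by
   exponential decay, at the lower end because [z > 0]. *)
pose c n := u n `^ z * - expR (- u n) - (u n)^-1 `^ z * - expR (- (u n)^-1).
have c0 : c n @[n --> \oo] --> 0.
  rewrite -[0](subrr 0); apply: cvgB.
    apply: (@squeeze_cvgr _ _ _ _ (fun n => - ((Num.truncn z).+2`!%:R * (u n)^-1)) (cst 0)).
    - near=> n; rewrite mulrN lerN2 powR_expRN_le ?(ltW z0) ?(ltW (u1 n)) //=.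
      by rewrite oppr_le0 mulr_ge0 ?powR_ge0 ?expR_ge0.
    - rewrite -[0]oppr0 -[in X in _ --> X](mulr0 (Num.truncn z).+2`!%:R); apply: cvgN; apply: cvgM; first exact: cvg_cst.
      by apply/gtr0_cvgV0 => //; near=> n.
    - exact: cvg_cst.
  apply: (@squeeze_cvgr _ _ _ _ (fun n => - (u n `^ (- z))) (cst 0)).
  - near=> n; rewrite mulrN oppr_le0 mulr_ge0 ?powR_ge0 ?expR_ge0 // andbT lerN2.
    rewrite powRN -[(u n)^-1]powR_inv1 ?(ltW (u0 n)) // -powRrM mulN1r powRN.
    by rewrite ler_piMr ?invr_ge0 ?powR_ge0 // expR_le1 oppr_le0 powR_ge0.
  - by rewrite -[X in _ --> X]oppr0; apply: cvgN; exact: cvg_powRN.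
  - exact: cvg_cst.
have E n : (\int[mu]_(t in `[((u n)^-1)%R, u n]) (t `^ (z + 1 - 1) * expR (- t))%:E =
   (c n)%:E + z%:E * \int[mu]_(t in `[((u n)^-1)%R, u n]) (t `^ (z - 1) * expR (- t))%:E)%E.
  have pos t : t \in `[(u n)^-1, u n] -> 0 < t.
    by rewrite in_itv /= => /andP[+ _]; apply: lt_le_trans; rewrite invr_gt0.
  have pos' t : t \in `](u n)^-1, u n[ -> 0 < t.
    by rewrite in_itv /= => /andP[+ _]; apply: lt_trans; rewrite invr_gt0.
  have cE : continuous (fun t : R => expR (- t)).
    move=> t; apply: (@continuous_comp _ _ _ -%R expR); first exact: opp_continuous.
    exact: continuous_expR.
  have dE t : is_derive t 1 (fun t : R => - expR (- t)) (expR (- t)).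
    apply: is_derive_eq; rewrite /GRing.scale /=. ring.
  rewrite addrK (integration_by_parts (F := @powR R ^~ z) (G := fun t => - expR (- t))
     (f := fun t => z * t `^ (z - 1)) (g := fun t => expR (- t))).
  - rewrite -/(c n); congr (_ + _)%E.
    rewrite -ge0_integralZl_EFin ?(ltW z0) //; last 2 first.
    + by move=> t _; rewrite lee_fin mulr_ge0 ?powR_ge0 ?expR_ge0.
    + by apply/measurable_EFinP; exact: measurable_gamma_integrand.
    rewrite -[RHS]oppeK -integral_ge0N => [|t _]; last first.
      by rewrite mule_ge0 ?lee_fin ?(ltW z0) // mulr_ge0 ?powR_ge0 ?expR_ge0.
    by congr (- _)%E; apply: eq_integral => t _; rewrite -EFinM -EFinN mulrN mulrA.
  - by rewrite (@lt_trans _ _ 1) // invf_lt1.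
  - apply: continuous_in_subspaceT => t /set_mem /pos t0.
    apply: cvgM; [exact: cvg_cst|exact: continuous_powR_gt0].
  - split.
    + by move=> t /pos' t0; apply: derivable_powR; rewrite in_itv /= andbT.
    + by apply/cvg_at_right_filter/continuous_powR_gt0; rewrite invr_gt0.
    + by apply/cvg_at_left_filter/continuous_powR_gt0.
  - by move=> t /pos' t0; apply: powR_derive1; rewrite in_itv /= andbT.
  - by apply: continuous_subspaceT.
  - split.
    + by move=> t _; apply: ex_derive.
    + by apply/cvg_at_right_filter; apply: cvgN; exact: cE.
    + by apply/cvg_at_left_filter; apply: cvgN; exact: cE.
  - by move=> t _; rewrite derive1E; exact: (@derive_val _ _ _ _ _ _ _ (dE t)).
move: cf1; under eq_fun do rewrite E.
move=> cf1; apply: (cvg_unique _ cf1) => //.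
have cE : (c n)%:E @[n --> \oo] --> 0%E by apply: cvg_EFin c0; near=> n.
have := cvgeD _ cE (cvgeZl (fin_numE z%:E) cf0); rewrite add0e; apply.
by rewrite fin_num_adde_defr.
Unshelve. all: by end_near. Qed.

Lemma gammae_ge0 z : (0 <= gammae z)%E.
Proof. by apply: integral_ge0 => t _; rewrite lee_fin mulr_ge0 ?powR_ge0 ?expR_ge0. Qed.

Lemma gammae1 : gammae (1 : R) = 1%:E.
Proof.
have cE : continuous (fun t : R => expR (- t)).
  move=> t; apply: (@continuous_comp _ _ _ -%R expR); first exact: opp_continuous.
  exact: continuous_expR.
have dE t : is_derive t 1 (fun t : R => - expR (- t)) (expR (- t)).
  by apply: is_derive_eq; rewrite /GRing.scale /=; ring.
rewrite /gammae subrr.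
under eq_integral => t _ do rewrite powRr0 mul1r.
rewrite integral_itv_obnd_cbnd; last first.
  by apply/measurable_EFinP; apply: measurable_funTS; exact: continuous_measurable_fun.
rewrite (@ge0_continuous_FTC2y _ _ (fun t => - expR (- t)) _ 0).
- by rewrite oppr0 expR0 EFinN oppeK add0e.
- by move=> t _; exact: expR_ge0.
- by apply: continuous_subspaceT.
- by rewrite -[X in _ --> X]oppr0; apply: cvgN; exact: cvgr_expR.
- by move=> t _; apply: ex_derive.
- by apply/cvg_at_right_filter; apply: cvgN; exact: cE.
- by move=> t _; rewrite derive1E; exact: (@derive_val _ _ _ _ _ _ _ (dE t)).
Qed.

(* The tangent line of the concave function [t |-> t `^ s] at [z]. *)
Lemma powR_le_tangent z s t : 0 < z -> 0 < t -> 0 <= s <= 1 ->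
  t `^ s <= (1 - s) * z `^ s + s * z `^ (s - 1) * t.
Proof.
move=> z0 t0 /andP[s0 s1].
set y := ln t - ln z.
have h1 := expR_ge1Dx (- (s * y)); have h2 := expR_ge1Dx ((1 - s) * y).
have E1 : expR (- (s * y)) = z `^ s / t `^ s.
  by rewrite /powR !gt_eqF // -expRN -expRD; congr expR; rewrite /y; ring.
have E2 : expR ((1 - s) * y) = z `^ (s - 1) * t / t `^ s.
  rewrite -[X in _ * X / _](@lnK _ t) ?posrE // /powR !gt_eqF // -expRN -!expRD; congr expR.
  by rewrite /y; ring.
have ts : 0 < t `^ s by rewrite powR_gt0.
have h : 1 <= (1 - s) * (z `^ s / t `^ s) + s * (z `^ (s - 1) * t / t `^ s).
  rewrite -E1 -E2.
  have a1 : (1 - s) * (1 - s * y) <= (1 - s) * expR (- (s * y)) by apply: ler_wpM2l => //; lra.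
  have a2 : s * (1 + (1 - s) * y) <= s * expR ((1 - s) * y) by apply: ler_wpM2l => //; lra.
  by apply: le_trans (lerD a1 a2); apply: eq_ler; ring.
rewrite -[leLHS]mul1r; apply: (@le_trans _ _ (((1 - s) * (z `^ s / t `^ s) + s * (z `^ (s - 1) * t / t `^ s)) * t `^ s)).
  by rewrite ler_wpM2r // ltW.
by apply: eq_ler; field; rewrite gt_eqF.
Qed.

(** The tangent bound integrated against [t^(z - 1) e^(- t)]. It takes the place of the
    log-convexity of Gamma between [z] and [z + 1]. *)
Lemma gammae_le z s : 0 < z -> 0 <= s <= 1 ->
  (gammae (z + s)%R <= ((1 - s) * z `^ s)%:E * gammae z + (s * z `^ (s - 1))%:E * gammae (z + 1)%R)%E.
Proof.
move=> z0 /[dup] s01 /andP[s0 s1].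
have m w : measurable_fun `](0 : R), +oo[ (fun t => (t `^ (w - 1) * expR (- t))%:E).
  by apply/measurable_EFinP; exact: measurable_gamma_integrand.
have ge w t : (0 <= (t `^ (w - 1) * expR (- t))%:E)%E.
  by rewrite lee_fin mulr_ge0 ?powR_ge0 ?expR_ge0.
have c1 : 0 <= (1 - s) * z `^ s by rewrite mulr_ge0 ?powR_ge0 // subr_ge0.
have c2 : 0 <= s * z `^ (s - 1) by rewrite mulr_ge0 ?powR_ge0.
rewrite /gammae -!ge0_integralZl_EFin //=; [|exact: m..].
rewrite -ge0_integralD //=; last 4 first.
- by move=> t _; rewrite mule_ge0 ?lee_fin // mulr_ge0 ?powR_ge0 ?expR_ge0.
- by apply: measurable_funeM; exact: m.
- by move=> t _; rewrite mule_ge0 ?lee_fin // mulr_ge0 ?powR_ge0 ?expR_ge0.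
- by apply: measurable_funeM; exact: m.
apply: ge0_le_integral => //=.
- exact: m.
- by apply: emeasurable_funD; apply: measurable_funeM; exact: m.
move=> t; rewrite in_itv /= andbT => t0.
rewrite -!EFinM -EFinD lee_fin.
have -> : t `^ (z + s - 1) = t `^ (z - 1) * t `^ s.
  by rewrite -powRD ?(gt_eqF t0) ?implybT //; congr powR; ring.
have -> : t `^ (z + 1 - 1) = t `^ (z - 1) * t.
  rewrite -[X in _ * X]powRr1 ?(ltW t0) // -powRD ?(gt_eqF t0) ?implybT //; congr powR; ring.
have h := powR_le_tangent z0 t0 s01.
have p : 0 <= t `^ (z - 1) * expR (- t) by rewrite mulr_ge0 ?powR_ge0 ?expR_ge0.
have := ler_wpM2l p h.
set A := t `^ (z - 1); set B := t `^ s; set C := z `^ s; set D := z `^ (s - 1).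
by move=> hh; apply: le_trans (le_trans hh _); apply: eq_ler; ring.
Qed.

(** From the value at [1], the convexity bound gives finiteness on [[1, 2]]; on []0, 1]] an infinite
    value would make the value at [s + 1] infinite by the functional equation; induction covers the
    rest. *)
Lemma gammae_fin z : 0 < z -> gammae z \is a fin_num.
Proof.
have aux (w : R) : 0 < w -> gammae w \is a fin_num -> gammae (w + 1) \is a fin_num.
  by move=> w0 h; rewrite gammae_rec // fin_numM.
have base s : 0 <= s <= 1 -> gammae (1 + s) \is a fin_num.
  move=> s01; rewrite ge0_fin_numE ?gammae_ge0 //.
  apply: le_lt_trans (gammae_le ltr01 s01) _.
  by rewrite gammae_rec // gammae1 -!EFinM -EFinD ltry.
have small (s : R) : 0 < s <= 1 -> gammae s \is a fin_num.
  move=> /andP[s0 s1]; have := base s; rewrite addrC gammae_rec // s1 ltW // => /(_ isT).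
  have := gammae_ge0 s; case: (gammae s) => [r| |] //= _.
  by rewrite gt0_muley // lte_fin.
have main n (w : R) : 0 < w <= n.+1%:R -> gammae w \is a fin_num.
  elim: n w => [|n IH] w /andP[w0 wn]; first by apply: small; rewrite w0.
  case: (lerP w 1) => w1; first by apply: small; rewrite w0.
  rewrite -(subrK 1 w); apply: aux; first by lra.
  by apply: IH; rewrite subr_gt0 w1 /= lerBlDr natr1.
move=> z0; apply: (main (Num.truncn z)); rewrite z0 /=.
by have /andP[_ /ltW] := truncn_itv (ltW z0).
Qed.

Lemma GammaE z : Gamma z = fine (gammae z).
Proof. by []. Qed.

Lemma Gamma_rec z : 0 < z -> Gamma (z + 1) = z * Gamma z.
Proof. by move=> z0; rewrite !GammaE gammae_rec // fineM // gammae_fin. Qed.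

Lemma Gamma1 : Gamma (1 : R) = 1.
Proof. by rewrite GammaE gammae1. Qed.

(** One half of Wendel's inequality: with the tangent taken at [z], the functional equation makes
    the two summands [(1 - s)] and [s] times the same quantity. *)
Lemma Gamma_addr_le z s : 0 < z -> 0 <= s <= 1 -> Gamma (z + s) <= z `^ s * Gamma z.
Proof.
move=> z0 s01; have := gammae_le z0 s01.
have h1 := gammae_fin z0; have h2 : gammae (z + s) \is a fin_num.
  by apply: gammae_fin; case/andP: s01 => s0 _; lra.
rewrite gammae_rec // !GammaE.
rewrite -(fineK h1) -(fineK h2) -!EFinM -EFinD lee_fin /= => h.
apply: le_trans h _.
have -> : s * z `^ (s - 1) * (z * fine (gammae z)) = s * z `^ s * fine (gammae z).
  have -> : z `^ s = z `^ (s - 1) * z.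
    rewrite -[X in _ * X]powRr1 ?(ltW z0) // -powRD ?(gt_eqF z0) ?implybT //; congr powR; ring.
  ring.
by apply: eq_ler; ring.
Qed.

Lemma Gamma_fact n : Gamma n.+1%:R = n`!%:R :> R.
Proof.
elim: n => [|n IH]; first by rewrite Gamma1.
by rewrite -natr1 Gamma_rec // IH factS natrM.
Qed.

Lemma Gamma_prod z n : 0 < z -> Gamma (z + n%:R) = (\prod_(i < n) (z + i%:R)) * Gamma z.
Proof.
move=> z0; elim: n => [|n IH]; first by rewrite addr0 big_ord0 mul1r.
by rewrite -natr1 addrA Gamma_rec ?IH ?big_ord_recr /= ?ltr_wpDr //; ring.
Qed.

(** On []0, 1]] the previous bound with [s = 1 - w] compares [Gamma w] with [Gamma 1 = 1] from
    below. *)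
Lemma Gamma_gt0 z : 0 < z -> 0 < Gamma z.
Proof.
have small (w : R) : 0 < w <= 1 -> 0 < Gamma w.
  move=> /andP[w0 w1].
  have /(Gamma_addr_le w0) : 0 <= 1 - w <= 1 by lra.
  rewrite addrC subrK Gamma1 => h.
  have : 0 < w `^ (1 - w) * Gamma w by lra.
  by rewrite pmulr_rgt0 // powR_gt0.
move=> z0; pose n := Num.truncn z; have /andP[h1 h2] := truncn_itv (ltW z0).
have [e|/negP ne] := eqVneq z n%:R.
  rewrite e; have : 0 < n%:R :> R by rewrite -e.
  by rewrite ltr0n; case: (n) => // m _; rewrite Gamma_fact ltr0n fact_gt0.
have nz : n%:R < z by rewrite lt_neqAle h1 andbT; apply/negP => /eqP e; apply: ne; rewrite e.
have w0 : 0 < z - n%:R by lra.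
rewrite -(subrK n%:R z) Gamma_prod // mulr_gt0 //.
  by apply: prodr_gt0 => i _; rewrite ltr_wpDr.
by apply: small; move: h2; rewrite -natr1; lra.
Qed.

Lemma cvgn_natr : n%:R @[n --> \oo] --> (+oo : set_system R).
Proof. by apply/cvgryPge => A; near=> n; near: n; exact: nbhs_infty_ger.
Unshelve. all: by end_near. Qed.

Lemma cvgn_natrV : n%:R^-1 @[n --> \oo] --> (0 : R).
Proof.
apply/gtr0_cvgV0; last exact: cvgn_natr.
by near=> n; rewrite ltr0n; near: n; exact: nbhs_infty_gt.
Unshelve. all: by end_near. Qed.

(** Reciprocal of Gauss's approximation to [Gamma z]. The product stops at [z + n - 1], hence the
    power [z - 1] of [n] instead of [z]. *)
Definition gauss_quot z (n : nat) : R :=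
  (\prod_(i < n) (z + i%:R)) / (n`!%:R * n%:R `^ (z - 1)).

Lemma prod_shift1 z n : 0 < z ->
  \prod_(i < n) (z + 1 + i%:R) = (\prod_(i < n) (z + i%:R)) * (z + n%:R) / z.
Proof.
move=> z0; elim: n => [|n IH]; first by rewrite !big_ord0 addr0 mul1r divff // gt_eqF.
rewrite !big_ord_recr /= IH -natr1; field; exact: lt0r_neq0.
Qed.

(** For [0 < w <= 1] the product is [Gamma (n + w) / Gamma w], and Wendel's bound is used twice:
    from [n] up to [n + w], and from [n + w] up to [n + 1]. The functional equation then extends the
    limit one unit at a time. *)
Lemma cvg_gauss_quot z : 0 < z -> gauss_quot z n @[n --> \oo] --> (Gamma z)^-1.
Proof.
have small (w : R) : 0 < w <= 1 -> gauss_quot w n @[n --> \oo] --> (Gamma w)^-1.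
  move=> /andP[w0 w1]; have G0 := Gamma_gt0 w0.
  apply: (@squeeze_cvgr _ _ _ _ (fun n => (Gamma w)^-1 * (1 + w * n%:R^-1)^-1) (fun n => (Gamma w)^-1)).
  - near=> n; have n0 : (0 < n)%N by near: n; exact: nbhs_infty_gt.
    have nR : 0 < n%:R :> R by rewrite ltr0n.
    rewrite /gauss_quot.
    have -> : \prod_(i < n) (w + i%:R) = Gamma (n%:R + w) / Gamma w.
      by rewrite addrC Gamma_prod // mulfK // gt_eqF.
    have f0 : 0 < n`!%:R :> R by rewrite ltr0n fact_gt0.
    have p0 : 0 < n%:R `^ (w - 1) :> R by rewrite powR_gt0.
    apply/andP; split.
      have s01 : 0 <= 1 - w <= 1 by lra.
      have nw : 0 < n%:R + w by lra.
      have := Gamma_addr_le nw s01.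
      have -> : n%:R + w + (1 - w) = n.+1%:R by rewrite -natr1; ring.
      rewrite Gamma_fact => h.
      have h2 : (n%:R + w) `^ (1 - w) * n%:R `^ (w - 1) <= 1 + w * n%:R^-1.
        have -> : w - 1 = - (1 - w) by ring.
        rewrite powRN; rewrite ler_pdivrMr ?powR_gt0 //.
        have -> : n%:R + w = (1 + w * n%:R^-1) * n%:R by field; rewrite gt_eqF.
        have wn : 0 <= w * n%:R^-1 by rewrite mulr_ge0 ?invr_ge0 ?(ltW w0) ?(ltW nR).
        rewrite powRM ?(ltW nR) //; last by lra.
        rewrite ler_wpM2r ?powR_ge0 // ler1_powR //; lra.
      rewrite mulrAC mulrC ler_wpM2r ?invr_ge0 ?(ltW G0) //.
      rewrite ler_pdivlMr ?mulr_gt0 // mulrC ler_pdivrMr; last first.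
        by rewrite ltr_wpDr // mulr_ge0 ?invr_ge0 ?(ltW w0) ?(ltW nR).
      have g0 : 0 < Gamma (n%:R + w) by exact: Gamma_gt0.
      apply: (@le_trans _ _ ((n%:R + w) `^ (1 - w) * Gamma (n%:R + w) * n%:R `^ (w - 1))).
        by rewrite ler_wpM2r // ltW.
      by rewrite mulrAC mulrC ler_wpM2l // ltW.
    have s01 : 0 <= w <= 1 by lra.
    have := Gamma_addr_le nR s01; rewrite -[in Gamma n%:R](prednK n0) Gamma_fact => h.
    rewrite mulrAC ler_piMl ?invr_ge0 ?(ltW G0) // ler_pdivrMr ?mulr_gt0 // mul1r.
    apply: le_trans h _.
    rewrite -[in leRHS](prednK n0) factS (prednK n0) natrM.
    have -> : n%:R `^ w = n%:R `^ (w - 1) * n%:R.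
      rewrite -[X in _ * X]powRr1 ?(ltW nR) // -powRD ?(gt_eqF nR) ?implybT //; congr powR; ring.
    by apply: eq_ler; ring.
  - rewrite -[X in _ --> X]mulr1; apply: cvgM; first exact: cvg_cst.
    rewrite -[X in _ --> X]invr1; apply: cvgV; first exact: oner_neq0.
    rewrite -[X in _ --> X]addr0; apply: cvgD; first exact: cvg_cst.
    rewrite -[X in _ --> X](mulr0 w); apply: cvgM; first exact: cvg_cst.
    exact: cvgn_natrV.
  - exact: cvg_cst.
have step (w : R) : 0 < w -> gauss_quot w n @[n --> \oo] --> (Gamma w)^-1 ->
    gauss_quot (w + 1) n @[n --> \oo] --> (Gamma (w + 1))^-1.
  move=> w0 h; rewrite Gamma_rec // invfM.
  have -> : w^-1 * (Gamma w)^-1 = (Gamma w)^-1 * ((w * 0 + 1) / w) by ring.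
  have : gauss_quot w n * ((w * n%:R^-1 + 1) / w) @[n --> \oo] --> (Gamma w)^-1 * ((w * 0 + 1) / w).
    apply: cvgM => //; apply: cvgM; last exact: cvg_cst.
    apply: cvgD; last exact: cvg_cst.
    by apply: cvgM; [exact: cvg_cst|exact: cvgn_natrV].
  apply: cvg_trans; apply: near_eq_cvg; near=> n.
  have n0 : (0 < n)%N by near: n; exact: nbhs_infty_gt.
  have nR : 0 < n%:R :> R by rewrite ltr0n.
  rewrite /gauss_quot prod_shift1 //.
  have -> : n%:R `^ (w + 1 - 1) = n%:R `^ (w - 1) * n%:R :> R.
    rewrite -[X in _ * X]powRr1 ?(ltW nR) // -powRD ?(gt_eqF nR) ?implybT //; congr powR; ring.
  have p0 : n%:R `^ (w - 1) != 0 :> R by rewrite gt_eqF // powR_gt0.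
  have f0 : n`!%:R != 0 :> R by rewrite gt_eqF // ltr0n fact_gt0.
  by field; rewrite p0 f0 !gt_eqF.
have main m (w : R) : 0 < w <= m.+1%:R -> gauss_quot w n @[n --> \oo] --> (Gamma w)^-1.
  elim: m w => [|m IH] w /andP[w0 wn]; first by apply: small; rewrite w0.
  case: (lerP w 1) => w1; first by apply: small; rewrite w0.
  rewrite -(subrK 1 w); apply: step; first by lra.
  by apply: IH; rewrite subr_gt0 w1 /= lerBlDr natr1.
move=> z0; apply: (main (Num.truncn z)); rewrite z0 /=.
by have /andP[_ /ltW] := truncn_itv (ltW z0).
Unshelve. all: by end_near. Qed.

End Gamma_function.

(** * Stirling's formula *)

Section Stirling_formula.
Variable R : realType.
Implicit Types (t : R).
Notation mu := (@lebesgue_measure R).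

(** The substitution of [t ^ 2] for the variable gives twice the Gaussian integral; squaring maps
    the interval from [1 / v n] to [v n] onto the one from [1 / u n] to [u n]. *)
Lemma Gamma_half : Gamma (2^-1 : R) = Num.sqrt pi.
Proof.
pose v n : R := n.+2%:R; pose u n : R := v n ^+ 2.
have v1 n : 1 < v n by rewrite ltr1n.
have v0 n : 0 < v n by rewrite ltr0n.
have vn n : n%:R + 1 <= v n by rewrite natr1 ler_nat.
have un n : n%:R + 1 <= u n by apply: le_trans (vn n) _; rewrite ler_eXnr // ltW.
have ndv : nondecreasing_seq v by move=> m n mn; rewrite ler_nat !ltnS.
have ndu : nondecreasing_seq u.
  by move=> m n mn; rewrite lerXn2r ?nnegrE ?(ltW (v0 _)) // ndv.
have cl := cvg_integral_itv_inv ndu un (@measurable_gamma_integrand R 2^-1 _)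
   (fun t _ => mulr_ge0 (powR_ge0 _ _) (expR_ge0 _)).
have mg : measurable_fun `](0 : R), +oo[ (fun t => 2 * gauss_fun t).
  apply: measurable_funTS; apply: measurable_funM; first exact: measurable_cst.
  exact: measurable_gauss_fun.
have g0 t : 0 < t -> 0 <= 2 * gauss_fun t by move=> _; rewrite mulr_ge0 // gauss_fun_ge0.
have cr := cvg_integral_itv_inv ndv vn mg g0.
suff E n : (\int[mu]_(t in `[((u n)^-1)%R, u n]) (t `^ (2^-1 - 1) * expR (- t))%:E
   = \int[mu]_(t in `[((v n)^-1)%R, v n]) (2 * gauss_fun t)%:E)%E.
  move: cl; under eq_fun do rewrite E.
  move=> cl; rewrite GammaE /gammae (cvg_unique _ cl cr) //.
  under eq_integral do rewrite EFinM.
  rewrite ge0_integralZl_EFin //; last 2 first.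
  - by move=> t _; rewrite lee_fin gauss_fun_ge0.
  - by apply/measurable_EFinP; apply: measurable_funTS; exact: measurable_gauss_fun.
  rewrite integral_itv_obnd_cbnd; last first.
    by apply/measurable_EFinP; apply: measurable_funTS; exact: measurable_gauss_fun.
  by rewrite integral0y_gauss -EFinM /= mulrC divfK.
have dsq t : is_derive t 1 (fun t : R => t ^+ 2) (2 * t).
  by apply: is_derive_eq; rewrite /GRing.scale /=; ring.
have derE : (fun t : R => t ^+ 2)^`()%classic = (fun t => 2 * t).
  by apply/funext => t; rewrite derive1E; exact: (@derive_val _ _ _ _ _ _ _ (dsq t)).
have cont t : {for t, continuous (fun t : R => t ^+ 2)} by exact: exprn_continuous.
have cont2 : continuous (fun t : R => 2 * t).
  by move=> t; apply: cvgM; [exact: cvg_cst|exact: cvg_id].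
have vi0 : 0 < (v n)^-1 by rewrite invr_gt0.
have -> : (u n)^-1 = (v n)^-1 ^+ 2 by rewrite /u exprVn.
rewrite (@integration_by_substitution_increasing _ (fun t => t ^+ 2)).
- apply: eq_integral => t /set_mem /=; rewrite in_itv /= => /andP[vt _].
  have t0 : 0 < t by apply: lt_le_trans vt.
  congr EFin; rewrite fctE /= derE /gauss_fun.
  rewrite -powR_mulrn ?(ltW t0) // -powRrM.
  have -> : 2%:R * (2^-1 - 1) = -1 :> R by field.
  rewrite powR_inv1 ?(ltW t0) //; field; exact: lt0r_neq0.
- by rewrite (@le_trans _ _ 1) ?(ltW (v1 n)) // invf_le1 // ltW.
- move=> s t; rewrite !in_itv /= => /andP[vs _] /andP[vt _] st.
  by rewrite ltr_pXn2r // nnegrE ltW // (lt_le_trans vi0).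
- by move=> t _; rewrite derE; exact: cont2.
- by rewrite derE; apply: cvgP; apply/cvg_at_right_filter; exact: cont2.
- by rewrite derE; apply: cvgP; apply/cvg_at_left_filter; exact: cont2.
- split.
  + by move=> t _; apply: ex_derive.
  + by apply/cvg_at_right_filter; exact: cont.
  + by apply/cvg_at_left_filter; exact: cont.
- apply: continuous_in_subspaceT => t /set_mem /=; rewrite in_itv /= => /andP[vt _].
  have t0 : 0 < t by apply: lt_le_trans vt; rewrite exprn_gt0.
  apply: cvgM; first exact: continuous_powR_gt0.
  apply: (@continuous_comp _ _ _ -%R expR); first exact: opp_continuous.
  exact: continuous_expR.
Qed.

Lemma le_is_derive_ge0 (f f' : R -> R) a b : a <= b ->
  (forall t, a <= t -> is_derive t 1 f (f' t)) ->
  (forall t, a <= t -> 0 <= f' t) -> f a <= f b.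
Proof.
move=> ab df f'0.
apply: (@ger0_derive1_le_cc _ f a b) => //.
- by move=> t; rewrite in_itv /= => /andP[/ltW /df []].
- move=> t; rewrite in_itv /= => /andP[/ltW at0 _]; have := df _ at0.
  by move=> d; rewrite derive1E (@derive_val _ _ _ _ _ _ _ d) f'0.
- apply: continuous_in_subspaceT => t /set_mem /=; rewrite in_itv /= => /andP[at0 _].
  by have [d _] := df _ at0; apply: differentiable_continuous; apply/derivable1_diffP.
- by rewrite in_itv /= lexx.
- by rewrite in_itv /= lexx ab.
Qed.

(** A Padé approximant of the logarithm. At [t = 1 + 1 / x] it equals [1 / (x + 1/2)], exactly what
    makes the sequence [l] below decrease. *)
Lemma ln_ge_pade t : 1 <= t -> 2 * (t - 1) / (t + 1) <= ln t.
Proof.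
move=> t1; rewrite -subr_ge0.
have -> : 0 = ln 1 - 2 * (1 - 1) / (1 + 1) :> R by rewrite ln1; field.
apply: (@le_is_derive_ge0 (fun t => ln t - 2 * (t - 1) / (t + 1))
   (fun t => (t - 1) ^+ 2 / (t * (t + 1) ^+ 2))) => // s s1.
  have s0 : 0 < s by lra.
  have s10 : s + 1 != 0 by rewrite gt_eqF //; lra.
  have dln := is_derive1_ln s0.
  apply: is_derive_eq.
  rewrite /GRing.scale /=; field; rewrite s10 gt_eqF //.
rewrite divr_ge0 ?sqr_ge0 // mulr_ge0 ?sqr_ge0 //; lra.
Qed.

(** The trapezoid rule for the convex function [1 / s] on [[1, t]]. At [t = 1 + 1 / x] it bounds the
    decrease of [l] by a telescoping quantity. *)
Lemma ln_le_trapezoid t : 1 <= t -> ln t <= (t - t^-1) / 2.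
Proof.
move=> t1; rewrite -subr_ge0.
have -> : 0 = (1 - 1^-1) / 2 - ln 1 :> R by rewrite ln1; field.
apply: (@le_is_derive_ge0 (fun t => (t - t^-1) / 2 - ln t)
   (fun t => (1 - t^-1) ^+ 2 / 2)) => // s s1.
  have s0 : 0 < s by lra.
  have dln := is_derive1_ln s0.
  have sn0 : s != 0 by rewrite gt_eqF.
  have dV : is_derive s 1 (fun y : R => y^-1) (- s ^- 2 *: 1) by apply: (@is_deriveV _ id).
  apply: is_derive_eq.
  rewrite /GRing.scale /=; field; rewrite gt_eqF //.
by rewrite divr_ge0 ?sqr_ge0.
Qed.

(** The logarithm of [stirling_quot n.+1]; the shift keeps the logarithms at positive arguments. *)
Let l (n : nat) : R := ln n.+1`!%:R + n.+1%:R - (n.+1%:R + 2^-1) * ln n.+1%:R.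

Lemma stirling_log_step n :
  0 <= l n - l n.+1 <= (n.+1%:R^-1 - n.+2%:R^-1) / 4.
Proof.
pose x : R := n.+1%:R; have x0 : 0 < x by rewrite ltr0n.
have -> : l n - l n.+1 = (x + 2^-1) * ln (1 + x^-1) - 1.
  have -> : 1 + x^-1 = n.+2%:R / x by rewrite -natr1 -/x; field; rewrite gt_eqF.
  rewrite /l ln_div ?posrE ?ltr0n // (factS n.+1) natrM lnM ?posrE ?ltr0n ?fact_gt0 //.
  have -> : n.+2%:R = x + 1 :> R by rewrite natr1.
  by rewrite -/x; ring.
have -> : n.+2%:R = x + 1 :> R by rewrite natr1.
rewrite -/x; move: x x0 => {n} x x0.
have xi : 0 < x^-1 by rewrite invr_gt0.
have y1 : 1 <= 1 + x^-1 by lra.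
have h1 := ln_ge_pade y1; have h2 := ln_le_trapezoid y1.
have xh : 0 <= x + 2^-1 by lra.
have {}h1 := ler_wpM2l xh h1; have {}h2 := ler_wpM2l xh h2.
have e1 : (x + 2^-1) * (2 * (1 + x^-1 - 1) / (1 + x^-1 + 1)) = 1.
  by field; rewrite !gt_eqF //=; lra.
have e2 : (x + 2^-1) * ((1 + x^-1 - (1 + x^-1)^-1) / 2) = 1 + (x^-1 - (x + 1)^-1) / 4.
  by field; rewrite !gt_eqF //=; lra.
rewrite e1 in h1; rewrite e2 in h2; lra.
Qed.

Definition stirling_quot (n : nat) : R :=
  n`!%:R / (Num.sqrt n%:R * n%:R ^+ n * expR (- n%:R)).

Lemma stirling_quotE n : stirling_quot n.+1 = expR (l n).
Proof.
have x0 : 0 < n.+1%:R :> R by rewrite ltr0n.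
rewrite /l expRB expRD lnK ?posrE ?ltr0n ?fact_gt0 // mulrDl expRD.
have -> : expR (n.+1%:R * ln n.+1%:R) = n.+1%:R ^+ n.+1 :> R.
  by rewrite expRM_natl lnK ?posrE.
have -> : expR (2^-1 * ln n.+1%:R) = Num.sqrt n.+1%:R :> R.
  by rewrite -powR12_sqrt ?(ltW x0) // /powR gt_eqF.
rewrite /stirling_quot expRN; field.
by rewrite expR_eq0 sqrtr_eq0 -ltNge x0 expf_eq0 gt_eqF.
Qed.

(** The logarithms decrease, and the telescoping bound keeps them above [l 0 - 1/4]. The limit is
    positive because it is an exponential; its value is identified afterwards. *)
Lemma is_cvg_stirling_quot : exists2 D : R, 0 < D & stirling_quot n @[n --> \oo] --> D.
Proof.
have nil : nonincreasing_seq l.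
  apply/nonincreasing_seqP => n; have /andP[h _] := stirling_log_step n.
  by rewrite -subr_ge0.
have lb n : l 0 - 4^-1 + n.+1%:R^-1 / 4 <= l n.
  elim: n => [|n IH]; first by rewrite invr1 mul1r subrK.
  have /andP[_] := stirling_log_step n; move: IH.
  by move: (l 0) (l n) (l n.+1) (n.+1%:R^-1) (n.+2%:R^-1) => *; lra.
have cl : cvgn l.
  apply: nonincreasing_is_cvgn => //; exists (l 0 - 4^-1) => _ [n _ <-].
  apply: le_trans (lb n); rewrite lerDl mulr_ge0 //.
exists (expR (limn l)); first exact: expR_gt0.
rewrite -cvg_shiftS /=.
apply: (@cvg_trans _ (expR (l n) @[n --> \oo])).
  by apply: near_eq_cvg; near=> n; rewrite stirling_quotE.
apply: (@cvg_comp _ _ _ l expR _ (nbhs (limn l))) => //.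
exact: continuous_expR.
Unshelve. all: by end_near. Qed.

Lemma prod_half n : (\prod_(i < n) (2^-1 + i%:R)) * (4 ^+ n * n`!%:R) = n.*2`!%:R :> R.
Proof.
elim: n => [|n IH]; first by rewrite big_ord0 !mul1r.
rewrite doubleS !factS !natrM -IH big_ord_recr /= exprS.
have -> : n.*2.+2%:R = 2 * (n%:R + 1) :> R by rewrite -addn2 natrD -mul2n natrM; ring.
have -> : n.*2.+1%:R = 2 * (2^-1 + n%:R) :> R by rewrite -addn1 natrD -mul2n natrM; field.
by rewrite -natr1; ring.
Qed.

(** By [prod_half], [stirling_quot (2 n) / stirling_quot n ^ 2] is [gauss_quot 2^-1 n / sqrt 2]. The
    limits are [1 / D] on one side and [1 / sqrt (2 pi)], from [Gamma_half], on the other. *)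
Lemma cvg_stirling_quot : stirling_quot n @[n --> \oo] --> Num.sqrt (2 * pi).
Proof.
have [D D0 cD] := is_cvg_stirling_quot.
suff -> : Num.sqrt (2 * pi) = D by [].
have c2 : stirling_quot n.*2 @[n --> \oo] --> D.
  apply: (@cvg_comp _ _ _ double stirling_quot _ \oo) => //.
  move=> A [m _ hm]; exists m => // n /= mn; apply: hm => /=.
  by apply: leq_trans mn _; rewrite -addnn leq_addr.
have c3 : stirling_quot n.*2 / (stirling_quot n * stirling_quot n) @[n --> \oo] --> D / (D * D).
  apply: cvgM => //; apply: cvgV; first by rewrite mulf_neq0 // gt_eqF.
  exact: cvgM.
have h0 : 0 < 2^-1 :> R by rewrite invr_gt0.
have c4 : gauss_quot 2^-1 n / Num.sqrt 2 @[n --> \oo] --> (Gamma (2^-1 : R))^-1 / Num.sqrt 2.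
  by apply: cvgM; [exact: cvg_gauss_quot|exact: cvg_cst].
have c5 : gauss_quot 2^-1 n / Num.sqrt 2 @[n --> \oo] --> D / (D * D).
  apply: cvg_trans c3; apply: near_eq_cvg; near=> n.
  have n0 : (0 < n)%N by near: n; exact: nbhs_infty_gt.
  have nR : 0 < n%:R :> R by rewrite ltr0n.
  rewrite /gauss_quot /stirling_quot -prod_half.
  have -> : n%:R `^ (2^-1 - 1) = (Num.sqrt n%:R)^-1 :> R.
    by rewrite -powR12_sqrt ?(ltW nR) // -powRN; congr powR; field.
  rewrite -[in n.*2%:R]mul2n natrM sqrtrM // exprMn expRN (expRN n%:R).
  rewrite -[in (2 ^+ n.*2)]mul2n exprM.
  have -> : n%:R ^+ n.*2 = n%:R ^+ n * n%:R ^+ n :> R by rewrite -exprD addnn.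
  have -> : expR (2 * n%:R) = expR n%:R * expR n%:R :> R by rewrite mulr2n mulrDl !mul1r expRD.
  have -> : 2 ^+ 2 = 4 :> R by ring.
  have f0 : n`!%:R != 0 :> R by rewrite pnatr_eq0 -lt0n fact_gt0.
  have s0 : Num.sqrt n%:R != 0 :> R by rewrite sqrtr_eq0 -ltNge.
  have s2 : Num.sqrt 2 != 0 :> R by rewrite sqrtr_eq0 -ltNge.
  have e0 : expR n%:R != 0 :> R by rewrite expR_eq0.
  have p0 : n%:R ^+ n != 0 :> R by rewrite expf_eq0 gt_eqF ?andbF.
  have q0 : 4 ^+ n != 0 :> R by rewrite expf_eq0 gt_eqF ?andbF.
  by field; rewrite f0 s0 s2 e0 p0 q0.
have := cvg_unique _ c4 c5; rewrite Gamma_half => /(_ (@Rhausdorff R)) E.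
rewrite sqrtrM // mulrC.
have s2 : Num.sqrt 2 != 0 :> R by rewrite sqrtr_eq0 -ltNge.
have sp : Num.sqrt pi != 0 :> R by rewrite sqrtr_eq0 -ltNge pi_gt0.
have Dn : D != 0 by rewrite gt_eqF.
apply: invr_inj; rewrite invfM E; field; exact: Dn.
Unshelve. all: by end_near. Qed.

End Stirling_formula.

(** * Truncated power series *)

Section truncated_power_series.
Variable R : realType.
Implicit Types (p q : {poly R}) (a b rho : R) (M : nat).

(** Power series are represented by polynomials of which only the coefficients up to [M] count;
    bounds uniform in [M] then hold for the whole series. *)
Definition trunc_norm rho M p : R := \sum_(i < M.+1) `|p`_i| * rho ^+ i.

Definition trunc_eq M p q := forall i, (i <= M)%N -> p`_i = q`_i.

Lemma trunc_norm_ge0 rho M p : 0 <= rho -> 0 <= trunc_norm rho M p.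
Proof. by move=> rho0; apply: sumr_ge0 => i _; rewrite mulr_ge0 ?exprn_ge0. Qed.

(** With coefficients replaced by their absolute values the norm is evaluation at [rho], which is
    multiplicative; truncating the product only drops nonnegative terms. *)
Lemma trunc_normM rho M p q : 0 <= rho ->
  trunc_norm rho M (p * q) <= trunc_norm rho M p * trunc_norm rho M q.
Proof.
move=> rho0.
pose A (s : {poly R}) : {poly R} := \poly_(i < M.+1) `|s`_i|.
have A0 s i : 0 <= (A s)`_i by rewrite coef_poly; case: ifP.
have E s : trunc_norm rho M s = (A s).[rho].
  rewrite (@horner_coef_wide _ M.+1) ?size_poly //; apply: eq_bigr => i _.
  by rewrite coef_poly ltn_ord.
rewrite (E p) (E q) -hornerM.
rewrite [leRHS](@horner_coef_wide _ (M.+1 + size (A p * A q)) _ rho) ?leq_addl //.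
rewrite big_split_ord /= -[leLHS]addr0; apply: lerD; last first.
  apply: sumr_ge0 => i _; rewrite mulr_ge0 ?exprn_ge0 // coefM.
  by apply: sumr_ge0 => k _; rewrite mulr_ge0.
apply: ler_sum => i _; rewrite ler_wpM2r ?exprn_ge0 // !coefM.
apply: le_trans (ler_norm_sum _ _ _) _; apply: ler_sum => k _.
have iM := ltn_ord i; have ki := ltn_ord k.
by rewrite normrM !coef_poly (leq_trans ki) // (leq_ltn_trans (leq_subr _ _)).
Qed.

Lemma trunc_norm_eq rho M p q : trunc_eq M p q -> trunc_norm rho M p = trunc_norm rho M q.
Proof. by move=> pq; apply: eq_bigr => i _; rewrite pq // -ltnS. Qed.

Lemma trunc_normC rho M a : trunc_norm rho M a%:P = `|a|.
Proof.
rewrite /trunc_norm big_ord_recl /= coefC eqxx mulr1 big1 ?addr0 // => i _.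
by rewrite coefC /= normr0 mul0r.
Qed.

Lemma trunc_eqM M p p' q q' :
  trunc_eq M p p' -> trunc_eq M q q' -> trunc_eq M (p * q) (p' * q').
Proof.
move=> pp qq i iM; rewrite !coefM; apply: eq_bigr => k _.
have ki := ltn_ord k.
by rewrite pp ?qq // (leq_trans _ iM) // leq_subr.
Qed.

Lemma trunc_eq_trans M p q s : trunc_eq M p q -> trunc_eq M q s -> trunc_eq M p s.
Proof. by move=> pq qs i iM; rewrite pq // qs. Qed.

Definition exp_poly M a : {poly R} := \poly_(i < M.+1) (a ^+ i / i`!%:R).

Lemma exp_poly0 M : trunc_eq M (exp_poly M 0) 1.
Proof.
move=> i iM; rewrite coef_poly ltnS iM coef1.
by case: i {iM} => [|i]; rewrite ?expr0 ?divr1 // expr0n mul0r.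
Qed.

Lemma exp_polyD M a b : trunc_eq M (exp_poly M a * exp_poly M b) (exp_poly M (a + b)).
Proof.
move=> m mM; rewrite coefM coef_poly ltnS mM addrC exprDn mulr_suml.
apply: eq_bigr => i _; have im := ltn_ord i.
rewrite !coef_poly (leq_trans im) // ltnS (leq_trans (leq_subr _ _)) //.
rewrite -mulr_natl -(bin_fact (ltnSE im)) !natrM.
have f0 k : k`!%:R != 0 :> R by rewrite pnatr_eq0 -lt0n fact_gt0.
have b0 : 'C(m, i)%:R != 0 :> R by rewrite pnatr_eq0 -lt0n bin_gt0.
by field; rewrite !f0 b0.
Qed.

Lemma exp_poly_sum M (I : Type) (s : seq I) (F : I -> R) :
  trunc_eq M (\prod_(i <- s) exp_poly M (F i)) (exp_poly M (\sum_(i <- s) F i)).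
Proof.
elim: s => [|x s IH]; first by rewrite !big_nil => i iM; rewrite exp_poly0.
rewrite !big_cons; apply: trunc_eq_trans (exp_polyD _ _).
exact: trunc_eqM.
Qed.

Lemma sum_exp_coeff_le a n : 0 <= a -> \sum_(i < n) a ^+ i / i`!%:R <= expR a.
Proof.
move=> a0.
have -> : \sum_(i < n) a ^+ i / i`!%:R = series (exp_coeff a) n.
  by rewrite /series /= big_mkord; apply: eq_bigr => i _; rewrite /exp_coeff.
apply: nondecreasing_cvgn_le; last exact: is_cvg_series_exp_coeff.
apply: nondecreasing_series => k _ _; rewrite /exp_coeff /=.
by rewrite divr_ge0 ?exprn_ge0.
Qed.

Lemma trunc_norm_exp_poly rho M a : 0 <= rho ->
  trunc_norm rho M (exp_poly M a) <= expR (`|a| * rho).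
Proof.
move=> rho0; apply: le_trans (sum_exp_coeff_le M.+1 _); last by rewrite mulr_ge0.
apply: ler_sum => i _; rewrite coef_poly ltn_ord normrM normfV normrX.
rewrite (@ger0_norm _ i`!%:R) // exprMn.
by apply: eq_ler; ring.
Qed.

(* Coefficients of the formal power series [p(v) * exp (a v)]. *)
Definition mul_exp_coef p a (m : nat) : R :=
  \sum_(i < m.+1) p`_i * (a ^+ (m - i) / (m - i)`!%:R).

Lemma mul_exp_coefE M p a m : (m <= M)%N ->
  (p * exp_poly M a)`_m = mul_exp_coef p a m.
Proof.
move=> mM; rewrite coefM; apply: eq_bigr => i _.
by rewrite coef_poly ltnS (leq_trans (leq_subr _ _)).
Qed.

(** Horner induction on [p]: multiplication by ['X] shifts the coefficients, and a constant
    contributes a multiple of the exponential series. *)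
Lemma cvg_sum_mul_exp_coef p a v :
  \sum_(m < M) mul_exp_coef p a m * v ^+ m @[M --> \oo] --> p.[v] * expR (a * v).
Proof.
elim/poly_ind: p => [|p c IH].
  rewrite horner0 mul0r; apply: (@cvg_trans _ ((0 : R) @[M --> \oo])); last exact: cvg_cst.
  apply: near_eq_cvg; near=> M; rewrite big1 // => m _.
  by rewrite /mul_exp_coef big1 ?mul0r // => i _; rewrite coef0 mul0r.
rewrite -cvg_shiftS /=.
have c0 m : mul_exp_coef (p * 'X + c%:P) a m.+1 = mul_exp_coef p a m + c * (a ^+ m.+1 / m.+1`!%:R).
  rewrite /mul_exp_coef big_ord_recl addrC; congr (_ + _); last first.
    by rewrite subn0 coefD coefMX coefC /= add0r.
  apply: eq_bigr => i _; rewrite /= /bump leq0n add1n subSS.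
  by rewrite coefD coefMX coefC /= addr0.
have c00 : mul_exp_coef (p * 'X + c%:P) a 0 = c.
  rewrite /mul_exp_coef big_ord1 coefD coefMX coefC /= add0r.
  by rewrite expr0 fact0 divr1 mulr1.
have E M : \sum_(m < M.+1) mul_exp_coef (p * 'X + c%:P) a m * v ^+ m =
    (\sum_(m < M) mul_exp_coef p a m * v ^+ m) * v + c * series (exp_coeff (a * v)) M.+1.
  rewrite /series /= big_mkord !big_ord_recl /= c00 mulr1.
  rewrite /exp_coeff /= expr0 fact0 divr1 mulrDr mulr1 addrCA; congr (_ + _).
  rewrite mulr_suml mulr_sumr -big_split; apply: eq_bigr => m _ /=.
  rewrite /bump leq0n add1n c0 exprMn (exprS v); ring.
under eq_fun do rewrite E.
rewrite hornerMXaddC mulrDl mulrAC; apply: cvgD.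
  by apply: cvgM; [exact: IH|exact: cvg_cst].
apply: cvgM; first exact: cvg_cst.
have := @is_cvg_series_exp_coeff R (a * v).
by move=> h; rewrite cvg_shiftS.
Unshelve. all: by end_near. Qed.

End truncated_power_series.

(** * Asymptotics of the coefficients of the rising factorial *)

Section mod_poisson.
Variables (R : realType) (r : R).
Hypothesis r_ge0 : 0 <= r.
Implicit Types (rho y : R) (n m M : nat).

(** The Weierstrass factors leave a harmonic sum in the exponent and [n^(- v)] brings [- ln n]; only
    their bounded difference remains. *)
Lemma harmonic_sub_ln n :
  0 <= \sum_(i < n) i.+1%:R^-1 - ln (n.+1%:R : R) <= 1 - n.+1%:R^-1.
Proof.
elim: n => [|n IH]; first by rewrite big_ord0 ln1 invr1 !subrr lexx.
rewrite big_ord_recr /=.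
set S := \sum_(i < n) _ in IH *.
pose x : R := n.+1%:R; have x0 : 0 < x by rewrite ltr0n.
have x1 : n.+2%:R = x + 1 :> R by rewrite natr1.
have -> : ln n.+2%:R = ln n.+1%:R + ln (1 + x^-1).
  rewrite -lnM ?posrE ?ltr0n //; last by rewrite addr_gt0 // invr_gt0.
  by congr ln; rewrite x1 -/x; field; rewrite gt_eqF.
have h1 : ln (1 + x^-1) <= x^-1.
  by apply: le_ln1Dx; apply: lt_trans (_ : 0 < _); rewrite ?invr_gt0 // oppr_lt0.
have h2 : (x + 1)^-1 <= ln (1 + x^-1).
  have -> : 1 + x^-1 = (x / (x + 1))^-1 by field; rewrite !gt_eqF //; lra.
  rewrite lnV ?posrE ?divr_gt0 //; last by lra.
  have -> : x / (x + 1) = 1 + - (x + 1)^-1 by field; rewrite gt_eqF //; lra.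
  rewrite lerNr; apply: le_ln1Dx; rewrite ltrN2 invf_lt1; lra.
rewrite x1 -/x.
have : 0 < (x + 1)^-1 by rewrite invr_gt0; lra.
move: IH; rewrite -/x; move: (ln _) (x^-1) ((x + 1)^-1) h1 h2 => *; lra.
Qed.

Lemma sum_inv_sqr_le n : \sum_(i < n) (i.+1%:R^-1) ^+ 2 <= 2 :> R.
Proof.
(* The bound is strengthened by a telescoping term so that the induction closes. *)
suff : \sum_(i < n) (i.+1%:R^-1) ^+ 2 <= 2 - 2 * n.+1%:R^-1 :> R.
  by move=> h; apply: le_trans h _; rewrite lerBlDr lerDl mulr_ge0.
elim: n => [|n IH]; first by rewrite big_ord0 invr1 mulr1 subrr.
rewrite big_ord_recr /=.
have -> : n.+2%:R = n.+1%:R + 1 :> R by rewrite natr1.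
have x1 : 1 <= n.+1%:R :> R by rewrite ler1n.
move: (n.+1%:R) x1 IH => x x1 IH.
suff : x^-1 ^+ 2 <= 2 * x^-1 - 2 * (x + 1)^-1 by lra.
have -> : 2 * x^-1 - 2 * (x + 1)^-1 = 2 / (x * (x + 1)) by field; rewrite !gt_eqF //; lra.
rewrite ler_pdivlMr; last by rewrite mulr_gt0; lra.
have -> : x^-1 ^+ 2 * (x * (x + 1)) = 1 + x^-1 by field; rewrite !gt_eqF //; lra.
have : x^-1 <= 1 by rewrite invf_le1; lra.
lra.
Qed.

(* Truncation of [(1 + w y) e^(- w y)] at [w = 'X + r]. *)
Definition weierstrass_factor M y : {poly R} :=
  (expR (- (r * y)))%:P * ((y%:P * 'X + (1 + r * y)%:P) * exp_poly M (- y)).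

(** The terms linear in [y] cancel in [(1 + w y) e^(- w y)], so each coefficient but the constant
    one carries a factor [y ^+ 2]; the constant one is at most [1] since [1 + r y <= e^(r y)]. *)
Lemma trunc_norm_weierstrass rho M y : 0 <= rho -> 0 <= y <= 1 ->
  trunc_norm rho M (weierstrass_factor M y) <= expR ((2 + r) * rho * expR rho * y ^+ 2).
Proof.
move=> rho0 /andP[y0 y1]; have r0 := r_ge0.
apply: le_trans (expR_ge1Dx _).
have e1 : expR (- (r * y)) <= 1 by rewrite expR_le1 oppr_le0 mulr_ge0.
have e0 : 0 <= expR (- (r * y)) by exact: expR_ge0.
have WE : weierstrass_factor M y = (expR (- (r * y)))%:P *
    (y%:P * (exp_poly M (- y) * 'X) + (1 + r * y)%:P * exp_poly M (- y)).
  by rewrite /weierstrass_factor; ring.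
rewrite /trunc_norm big_ord_recl /= mulr1; apply: lerD.
  rewrite WE coefCM coefD !coefCM coefMX /= mulr0 add0r.
  rewrite coef_poly /= expr0 divr1 mulr1 ger0_norm; last first.
    by rewrite mulr_ge0 // addr_ge0 // mulr_ge0.
  rewrite expRN mulrC ler_pdivrMr ?expR_gt0 // mul1r; exact: expR_ge1Dx.
apply: (@le_trans _ _ (\sum_(i < M) (2 + r) * y ^+ 2 * rho * (rho ^+ i / i`!%:R))); last first.
  rewrite -mulr_sumr; set T := \sum_(_ < _) _.
  have h : T <= expR rho by exact: sum_exp_coeff_le.
  have h0 : 0 <= (2 + r) * y ^+ 2 * rho.
    by apply: mulr_ge0 => //; apply: mulr_ge0; [lra|exact: sqr_ge0].
  by apply: le_trans (ler_wpM2l h0 h) _; apply: eq_ler; ring.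
apply: ler_sum => i _; rewrite /bump leq0n add1n.
have iM := ltn_ord i.
rewrite WE coefCM coefD !coefCM coefMX /= !coef_poly.
rewrite !ltnS iM (ltnW iM) normrM (ger0_norm e0).
have f0 : 0 < i`!%:R :> R by rewrite ltr0n fact_gt0.
have f1 : 1 <= i`!%:R :> R by rewrite ler1n fact_gt0.
have i1 : 1 <= i.+1%:R :> R by rewrite ler1n.
have -> : y * ((- y) ^+ i / i`!%:R) + (1 + r * y) * ((- y) ^+ i.+1 / i.+1`!%:R) =
   (- y) ^+ i * (y * (1 - (1 + r * y) / i.+1%:R)) / i`!%:R.
  rewrite exprS factS natrM; field.
  by rewrite !gt_eqF //; lra.
rewrite !normrM normfV (ger0_norm (ltW f0)) normrX normrN (ger0_norm y0).
rewrite exprS.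
(* For [i = 0] the difference is [- r y], which supplies the second factor [y]; for [i > 0] the
   power [y ^+ i] does. *)
have key : y ^+ i * (y * `|1 - (1 + r * y) / i.+1%:R|) <= (2 + r) * y ^+ 2.
  case: (nat_of_ord i) => [|k].
    rewrite expr0 mul1r divr1.
    have -> : 1 - (1 + r * y) = - (r * y) by ring.
    rewrite normrN ger0_norm ?mulr_ge0 //.
    have : 0 <= y ^+ 2 by rewrite sqr_ge0.
    have -> : y * (r * y) = r * y ^+ 2 by ring.
    move=> yy; rewrite ler_wpM2r //; lra.
  rewrite mulrA -exprSr.
  have k1 : 1 <= k.+2%:R :> R by rewrite ler1n.
  have ki : k.+2%:R^-1 <= 1 :> R by rewrite invf_le1 //; lra.
  have ki0 : 0 <= k.+2%:R^-1 :> R by rewrite invr_ge0; lra.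
  have ry : 0 <= r * y <= r by rewrite mulr_ge0 //= ler_piMr.
  have nrm : `|1 - (1 + r * y) / k.+2%:R| <= 2 + r.
    have a0 : 0 <= (1 + r * y) / k.+2%:R by rewrite mulr_ge0 //; lra.
    have a1 : (1 + r * y) / k.+2%:R <= 1 + r by apply: le_trans (ler_piMr _ ki) _; lra.
    by move: (_ / _) a0 a1 => q a0 a1; rewrite ler_norml; apply/andP; split; lra.
  rewrite mulrC; apply: ler_pM => //; first exact: exprn_ge0.
  by rewrite -[k.+2]addn2 exprD ler_piMl ?sqr_ge0 // exprn_ile1.
have -> : expR (- (r * y)) * (y ^+ i * (y * `|1 - (1 + r * y) / i.+1%:R|) / i`!%:R) * (rho * rho ^+ i) =
  (expR (- (r * y)) * (y ^+ i * (y * `|1 - (1 + r * y) / i.+1%:R|))) * (rho * (rho ^+ i / i`!%:R)) by ring.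
rewrite -[leRHS]mulrA; apply: ler_wpM2r.
  by rewrite mulr_ge0 // divr_ge0 // exprn_ge0.
apply: le_trans key; rewrite ler_piMl //.
by rewrite !mulr_ge0 // exprn_ge0.
Qed.

Definition normalizer n : R := n`!%:R * n%:R `^ (r - 1).

Lemma normalizer_gt0 n : (0 < n)%N -> 0 < normalizer n.
Proof. by move=> n0; rewrite mulr_gt0 ?ltr0n ?fact_gt0 // powR_gt0 // ltr0n. Qed.

(* Power series coefficients of [prod_(i < n) (v + r + i) * n^(- v) / normalizer n],
   whose value at [v] is [gauss_quot (v + r) n]. *)
Definition poisson_coef n m : R := mul_exp_coef (rising n r) (- ln n%:R) m / normalizer n.

Lemma poisson_coef_bound rho : 0 <= rho -> exists2 C : R, 0 <= C &
  forall n M, (0 < n)%N -> \sum_(m < M) `|poisson_coef n m| * rho ^+ m <= C.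
Proof.
move=> rho0; have r0 := r_ge0; pose K := (2 + r) * rho * expR rho.
have K0 : 0 <= K by rewrite !mulr_ge0 ?expR_ge0 //; lra.
(* The four factors bound, in this order, [e^(r gam)], the linear factor ['X + r], the Weierstrass
   product (its inverse squares sum to at most [2]), and the series of [e^(gam v)]. *)
pose C := expR r * ((rho + r) * (expR (K * 2) * expR rho)).
have C0 : 0 <= C by rewrite !mulr_ge0 ?expR_ge0 ?addr_ge0.
exists C => //.
move=> [//|n] [_|M _]; first by rewrite big_ord0.
pose N := n.+1; have N0 : 0 < N%:R :> R by rewrite ltr0n.
pose gam : R := \sum_(i < n) i.+1%:R^-1 - ln N%:R.
pose Y (i : 'I_n) : R := i.+1%:R^-1.
have Y01 (i : 'I_n) : 0 <= Y i <= 1.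
  by apply/andP; split; rewrite ?invr_ge0 // invf_le1 ?ler1n ?ltr0n.
have gam01 : 0 <= gam <= 1.
  have /andP[h1 h2] := harmonic_sub_ln n; rewrite h1 /=.
  by apply: le_trans h2 _; rewrite gerBl invr_ge0.
have -> : \sum_(m < M.+1) `|poisson_coef N m| * rho ^+ m =
   trunc_norm rho M ((normalizer N)^-1%:P * (rising N r * exp_poly M (- ln N%:R))).
  apply: eq_bigr => m _; rewrite coefCM mul_exp_coefE; last by rewrite -ltnS.
  by rewrite /poisson_coef [_ / _]mulrC.
(* Here [v + r + i + 1 = (i + 1) (1 + (v + r) / (i + 1))], while the factor [v + r] of index [0] is
   kept apart. The correcting exponentials and the power of [N] combine into [e^(gam (v + r))]. *)
have eqH : trunc_eq M ((normalizer N)^-1%:P * (rising N r * exp_poly M (- ln N%:R)))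
   ((expR (r * gam))%:P * (('X + r%:P) * ((\prod_(i < n) weierstrass_factor M (Y i)) * exp_poly M gam))).
  rewrite /weierstrass_factor !big_split /=.
  rewrite -rmorph_prod /= -expR_sum.
  have -> : \prod_(i < n) ((Y i)%:P * 'X + (1 + r * Y i)%:P) =
      (n`!%:R^-1)%:P * \prod_(i < n) ('X + (r + i.+1%:R)%:P).
    have -> : n`!%:R^-1 = \prod_(i < n) Y i.
      rewrite /Y prodfV -natr_prod; congr (_%:R^-1).
      by rewrite fact_prod big_add1 big_mkord.
    rewrite rmorph_prod /= -big_split /=; apply: eq_bigr => i _.
    rewrite mulrDr -rmorphM /=; congr (_ + _%:P).
    by rewrite /Y mulrDr mulVf ?pnatr_eq0 // mulrC addrC.
  rewrite /rising big_ord_recl /= addr0.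
  set Q := \prod_(i < n) ('X + (r + i.+1%:R)%:P).
  have cst : (normalizer N)^-1 = expR (r * gam) * (expR (\sum_(i < n) - (r * Y i)) * n`!%:R^-1).
    rewrite mulrA -expRD sumrN -mulr_sumr.
    have -> : r * gam - r * (\sum_i Y i) = - (r * ln N%:R) by rewrite /gam /Y; ring.
    have -> : expR (- (r * ln N%:R)) = (N%:R `^ r)^-1 by rewrite expRN /powR gt_eqF.
    have -> : N%:R `^ r = N%:R `^ (r - 1) * N%:R.
      rewrite -[X in _ * X]powRr1 ?(ltW N0) // -powRD ?(gt_eqF N0) ?implybT //; congr powR; ring.
    rewrite /normalizer /N factS natrM; field.
    by rewrite gt_eqF ?powR_gt0 // gt_eqF ?ltr0n ?fact_gt0 // gt_eqF.
  rewrite cst !rmorphM /=.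
  set e1 := (expR (r * gam))%:P; set e2 := (expR _)%:P; set e3 := (_^-1)%:P; set X := 'X + r%:P.
  set P := \prod_(i < n) exp_poly M (- Y i).
  have -> : e1 * (e2 * e3) * (X * \prod_(i < n) ('X + (r + (bump 0 i)%:R)%:P) * exp_poly M (- ln N%:R)) =
     (e1 * (e2 * e3) * X * Q) * exp_poly M (- ln N%:R).
    by rewrite -/Q; ring.
  have -> : e1 * (X * (e2 * (e3 * Q * P) * exp_poly M gam)) =
     (e1 * (e2 * e3) * X * Q) * (P * exp_poly M gam) by ring.
  apply: trunc_eqM => // i iM; apply/esym.
  have h1 := @exp_poly_sum R M _ (index_enum 'I_n) (fun i => - Y i).
  rewrite (trunc_eqM h1 (fun i _ => erefl) iM) exp_polyD //; congr ((exp_poly M _)`_i).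
  by rewrite sumrN /gam /Y; ring.
rewrite (trunc_norm_eq _ eqH).
apply: le_trans (trunc_normM _ _ _ rho0) _; apply: ler_pM; rewrite ?trunc_norm_ge0 //.
  rewrite trunc_normC ger0_norm ?expR_ge0 // ler_expR ler_piMr //; by case/andP: gam01.
apply: le_trans (trunc_normM _ _ _ rho0) _; apply: ler_pM; rewrite ?trunc_norm_ge0 //.
  rewrite /trunc_norm big_ord_recl /= coefD coefX coefC /= add0r mulr1 (ger0_norm r_ge0) addrC lerD2r.
  case: (M) => [|M']; first by rewrite big_ord0.
  rewrite big_ord_recl big1 ?addr0 => [|i _]; rewrite coefD coefX coefC /= addr0.
    by rewrite normr1 mul1r expr1.
  by rewrite normr0 mul0r.
apply: le_trans (trunc_normM _ _ _ rho0) _; apply: ler_pM; rewrite ?trunc_norm_ge0 //.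
  apply: (@le_trans _ _ (\prod_(i < n) trunc_norm rho M (weierstrass_factor M (Y i)))).
    elim/big_ind2: _ => [||//]; first by rewrite trunc_normC normr1.
    move=> p1 x1 p2 x2 h1 h2; apply: le_trans (trunc_normM _ _ _ rho0) _.
    by apply: ler_pM; rewrite ?trunc_norm_ge0.
  apply: (@le_trans _ _ (\prod_(i < n) expR (K * Y i ^+ 2))).
    by apply: ler_prod => i _; rewrite trunc_norm_ge0 //= trunc_norm_weierstrass.
  by rewrite -expR_sum ler_expR -mulr_sumr ler_wpM2l // sum_inv_sqr_le.
apply: le_trans (trunc_norm_exp_poly _ _ rho0) _; rewrite ler_expR.
by case/andP: gam01 => g0 g1; rewrite ger0_norm // ler_piMl.
Qed.

End mod_poisson.

(** * Coefficient extraction with a uniform error bound *)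

Section coefficient_asymptotics.
Variables (R : realType) (r : R).
Hypothesis r_ge0 : 0 <= r.

Lemma rising_coefE n j : (0 < n)%N ->
  (rising n r)`_j = normalizer r n *
    \sum_(m < j.+1) poisson_coef r n m * (ln n%:R ^+ (j - m) / (j - m)`!%:R).
Proof.
move=> n0; have N0 := lt0r_neq0 (normalizer_gt0 r n0).
have h : trunc_eq j (rising n r * exp_poly j (- ln n%:R) * exp_poly j (ln n%:R)) (rising n r).
  rewrite -mulrA -[X in trunc_eq _ _ X]mulr1; apply: trunc_eqM => // i ij.
  by rewrite exp_polyD // addNr exp_poly0.
rewrite -h // coefM mulr_sumr; apply: eq_bigr => m _.
rewrite mul_exp_coefE; last by rewrite -ltnS.
have f0 : (j - m)`!%:R != 0 :> R by rewrite pnatr_eq0 -lt0n fact_gt0.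
by rewrite coef_poly ltnS leq_subr /poisson_coef; field; rewrite N0 f0.
Qed.

(** Dividing by the Poisson weight [L^j / j!] turns [L^(j - m) / (j - m)!] into [(j ^_ m) / L^m],
    which is close to [y^m] when [j / L] is close to [y]. *)
Lemma rising_coef_quotE n j : (1 < n)%N ->
  (rising n r)`_j * j`!%:R / (normalizer r n * ln n%:R ^+ j) =
    \sum_(m < j.+1) poisson_coef r n m * ((j ^_ m)%:R / ln n%:R ^+ m).
Proof.
move=> n1; have n0 : (0 < n)%N by apply: ltnW.
have N0 := lt0r_neq0 (normalizer_gt0 r n0).
have L0 : 0 < ln n%:R :> R by rewrite ln_gt0 // ltr1n.
rewrite rising_coefE //; set U := \sum_(_ < _) poisson_coef _ _ _ * (_ / _`!%:R).
have -> : normalizer r n * U * j`!%:R / (normalizer r n * ln n%:R ^+ j) =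
    U * (j`!%:R / ln n%:R ^+ j).
  by field; rewrite N0 expf_eq0 gt_eqF // andbF.
rewrite mulr_suml; apply: eq_bigr => m _.
have mj : (m <= j)%N by rewrite -ltnS.
have -> : ln n%:R ^+ j = ln n%:R ^+ (j - m) * ln n%:R ^+ m :> R by rewrite -exprD subnK.
rewrite -(ffact_fact mj) natrM.
have f0 : (j - m)`!%:R != 0 :> R by rewrite pnatr_eq0 -lt0n fact_gt0.
by field; rewrite f0 !expf_eq0 !gt_eqF // !andbF.
Qed.

(** Each further factor loses at most a proportion [m / j]. The crude [m ^+ 2] is harmless because a
    weight [4 ^+ m] will absorb it. *)
Lemma ffact_exp_le j m : (0 < j)%N ->
  0 <= (j%:R : R) ^+ m - (j ^_ m)%:R <= m%:R ^+ 2 * j%:R ^+ m / j%:R.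
Proof.
move=> j0; have jR : 0 < j%:R :> R by rewrite ltr0n.
elim: m => [|m /andP[IH1 IH2]]; first by rewrite ffactn0 !expr0 subrr expr0n !mul0r lexx.
have J0 : 0 <= j%:R ^+ m :> R by rewrite exprn_ge0 // ltW.
set a := (j ^_ m)%:R in IH1 IH2.
have a0 : 0 <= a by rewrite ler0n.
have h : a * (j%:R - m%:R) <= a * (j - m)%:R.
  rewrite ler_wpM2l // lerBlDr -natrD ler_nat; lia.
have h' : a * (j - m)%:R <= a * j%:R by rewrite ler_wpM2l // ler_nat leq_subr.
rewrite ffactnSr natrM -/a exprSr.
apply/andP; split.
  rewrite subr_ge0; apply: le_trans h' _; rewrite ler_wpM2r ?(ltW jR) //; lra.
have -> : m.+1%:R ^+ 2 * (j%:R ^+ m * j%:R) / j%:R = m.+1%:R ^+ 2 * j%:R ^+ m :> R.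
  by field; rewrite gt_eqF.
have g1 : (j%:R ^+ m - a) * j%:R <= m%:R ^+ 2 * j%:R ^+ m.
  by rewrite -ler_pdivlMr.
have g2 : a * m%:R <= j%:R ^+ m * m%:R by rewrite ler_wpM2r //; lra.
have g3 : 0 <= m%:R * j%:R ^+ m :> R by rewrite mulr_ge0.
rewrite -natr1.
move: (j%:R ^+ m : R) (m%:R : R) (j%:R : R) ((j - m)%:R : R) J0 h g1 g2 g3 => A B C D *; nra.
Qed.

Lemma exprB_le (x y Y : R) m : 1 <= Y -> 0 <= x <= Y -> 0 <= y <= Y ->
  `|x ^+ m - y ^+ m| <= m%:R * Y ^+ m * `|x - y|.
Proof.
move=> Y1 /andP[x0 xY] /andP[y0 yY].
case: m => [|m]; first by rewrite !expr0 subrr normr0 !mul0r.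
rewrite subrXX normrM mulrC ler_wpM2r //.
apply: le_trans (ler_norm_sum _ _ _) _.
rewrite -[X in X%:R * _]card_ord mulr_natl -sumr_const; apply: ler_sum => i _.
have Y0 : 0 <= Y by lra.
rewrite ger0_norm ?mulr_ge0 ?exprn_ge0 //.
have im := ltn_ord i.
apply: (@le_trans _ _ (Y ^+ (m.+1 - i.+1)%N * Y ^+ i)).
  by apply: ler_pM; rewrite ?exprn_ge0 // lerXn2r ?nnegrE.
by rewrite -exprD ler_weXn2l //; lia.
Qed.

(** The term [j^-1] pays for replacing falling factorials by powers, the other for replacing
    [y = j / L] by [v]. In the weight [Y * 4], [Y ^+ m] bounds the powers of [y] and [v], and
    [4 ^+ m] absorbs [m ^+ 2] and [m]. Leaving [v] free lets it be a fixed limit later, so pointwise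
    convergence of [gauss_quot] is enough. *)
Lemma rising_coef_bound (Y : R) : 1 <= Y -> exists2 C : R, 0 <= C &
  forall n j (v : R), (1 < n)%N -> (0 < j)%N -> 0 <= v <= Y -> j%:R / ln n%:R <= Y ->
  `|(rising n r)`_j * j`!%:R / (normalizer r n * ln n%:R ^+ j) - gauss_quot (v + r) n|
    <= C * (j%:R^-1 + `|j%:R / ln n%:R - v|).
Proof.
move=> Y1; have Y0 : 0 <= Y * 4 by rewrite mulr_ge0 //; lra.
have [C C0 HC] := poisson_coef_bound r_ge0 Y0.
exists C => // n j v n1 j0 /andP[v0 vY].
set L := ln n%:R; set y := j%:R / L => yY.
have n0 : (0 < n)%N by apply: ltnW.
have nR : 0 < n%:R :> R by rewrite ltr0n.
have L0 : 0 < L by rewrite ln_gt0 // ltr1n.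
have jR : 0 < j%:R :> R by rewrite ltr0n.
have y0 : 0 <= y by rewrite divr_ge0 // ltW.
pose S M := \sum_(m < M) poisson_coef r n m * v ^+ m.
have cS : S M @[M --> \oo] --> gauss_quot (v + r) n.
  have -> : gauss_quot (v + r) n = (rising n r).[v] * expR (- L * v) * (normalizer r n)^-1.
    rewrite /rising horner_prod /gauss_quot /normalizer.
    have -> : \prod_(i < n) (v + r + i%:R) = \prod_(i < n) ('X + (r + i%:R)%:P).[v].
      by apply: eq_bigr => i _; rewrite hornerD hornerX hornerC addrA.
    have -> : n%:R `^ (v + r - 1) = n%:R `^ (r - 1) * expR (L * v).
      have -> : v + r - 1 = (r - 1) + v by ring.
      rewrite powRD ?(gt_eqF nR) ?implybT //; congr (_ * _).
      by rewrite {1}/powR gt_eqF // mulrC.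
    rewrite mulNr expRN; field.
    by rewrite expR_eq0 pnatr_eq0 -lt0n fact_gt0 gt_eqF // powR_gt0.
  apply: (@cvg_trans _ ((\sum_(m < M) mul_exp_coef (rising n r) (- L) m * v ^+ m) * (normalizer r n)^-1 @[M --> \oo])).
    apply: near_eq_cvg; near=> M; rewrite /S mulr_suml; apply: eq_bigr => m _.
    by rewrite /poisson_coef; ring.
  by apply: cvgM; [exact: cvg_sum_mul_exp_coef|exact: cvg_cst].
rewrite rising_coef_quotE // -/L.
set T := \sum_(_ < _) _.
(* Falling factorials vanish for [m > j], so [T] may be summed up to [M] and compared termwise with
   a partial sum of the full series. *)
have key M : (j < M)%N -> `|T - S M| <= C * (j%:R^-1 + `|y - v|).
  move=> jM.
  have -> : T = \sum_(m < M) poisson_coef r n m * ((j ^_ m)%:R / L ^+ m).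
    rewrite /T -!(big_mkord xpredT (fun m => poisson_coef r n m * ((j ^_ m)%:R / L ^+ m))).
    rewrite [RHS](big_cat_nat _ jM) //= [X in _ = _ + X]big_nat [X in _ = _ + X]big1 ?addr0 // => m /andP[jm _].
    by rewrite ffact_small // mul0r mulr0.
  rewrite /S -sumrB; apply: le_trans (ler_norm_sum _ _ _) _.
  apply: (@le_trans _ _ (\sum_(m < M) `|poisson_coef r n m| * (Y * 4) ^+ m * (j%:R^-1 + `|y - v|))); last first.
    rewrite -mulr_suml; apply: ler_wpM2r; last exact: HC.
    by rewrite addr_ge0 // invr_ge0 ltW.
  apply: ler_sum => m _; rewrite -mulrBr normrM -mulrA ler_wpM2l //.
  have -> : (j ^_ m)%:R / L ^+ m - v ^+ m = - ((j%:R ^+ m - (j ^_ m)%:R) / L ^+ m) + (y ^+ m - v ^+ m).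
    by rewrite /y expr_div_n; ring.
  apply: le_trans (ler_normD _ _) _.
  rewrite mulrDr normrN.
  have Lm : 0 < L ^+ m by rewrite exprn_gt0.
  have [f1 f2] := andP (ffact_exp_le m j0).
  have m4 : m%:R <= 2 ^+ m :> R by rewrite -natrX ler_nat ltnW // ltn_expl.
  have p2 : 0 <= 2 ^+ m :> R by rewrite exprn_ge0.
  have p21 : 1 <= 2 ^+ m :> R by rewrite exprn_ege1 // ler1n.
  have e4 : 4 ^+ m = 2 ^+ m * 2 ^+ m :> R by rewrite -exprMn; congr (_ ^+ _); ring.
  have Ym : 0 <= Y ^+ m by rewrite exprn_ge0 //; lra.
  apply: lerD.
    rewrite ger0_norm; last by rewrite divr_ge0 // ltW.
    apply: (@le_trans _ _ (m%:R ^+ 2 * y ^+ m * j%:R^-1)).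
      rewrite /y expr_div_n ler_pdivrMr //; apply: le_trans f2 _.
      by apply: eq_ler; field; rewrite !gt_eqF.
    rewrite ler_wpM2r ?invr_ge0 ?(ltW jR) // [(Y * 4) ^+ m]exprMn [_ * y ^+ m]mulrC e4.
    apply: ler_pM.
    - exact: exprn_ge0.
    - exact: sqr_ge0.
    - by rewrite lerXn2r ?nnegrE //; lra.
    - by rewrite expr2; apply: ler_pM.
  apply: le_trans (@exprB_le y v Y m Y1 _ _) _; [by rewrite y0 yY|by rewrite v0 vY|].
  rewrite ler_wpM2r // [(Y * 4) ^+ m]exprMn [m%:R * _]mulrC ler_wpM2l // e4.
  by apply: le_trans m4 _; rewrite ler_peMr.
have cT : `|T - S M| @[M --> \oo] --> `|T - gauss_quot (v + r) n|.
  by apply: cvg_norm; apply: cvgB => //; exact: cvg_cst.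
apply: (cvgr_to_le cT); near=> M; apply: key; near: M; exact: nbhs_infty_gt.
Unshelve. all: by end_near. Qed.

End coefficient_asymptotics.

(** * Tails of log-concave sequences *)

Section geometric_domination.
Variable R : realType.

Lemma cvgn_ext (u v : nat -> R) (l : R) :
  (\forall n \near \oo, u n = v n) -> u n @[n --> \oo] --> l -> v n @[n --> \oo] --> l.
Proof.
move=> uv; apply: cvg_trans; apply: near_eq_cvg.
by apply: filterS uv => n uvn; rewrite uvn.
Qed.

Lemma sum_geometric_le (t : R) N : 0 <= t < 1 -> \sum_(m < N) t ^+ m <= (1 - t)^-1.
Proof.
move=> /andP[t0 t1]; rewrite -[leRHS]mul1r ler_pdivlMr ?subr_gt0 //.
have -> : (\sum_(m < N) t ^+ m) * (1 - t) = 1 - t ^+ N.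
  by rewrite mulrC -opprB mulNr -subrX1 opprB.
by rewrite gerBl exprn_ge0.
Qed.

(** A form of Tannery's theorem whose dominating sequence varies with [n]. Fixed partial sums bound
    the limit from below, the dominating geometric sums from above, and the two bounds meet. *)
Lemma cvg_sum_geometric (f : nat -> nat -> R) (N : nat -> nat) (C t : nat -> R) (q : R) :
  0 < q < 1 ->
  (\forall n \near \oo, forall m, (m < N n)%N -> 0 <= f n m <= C n * t n ^+ m) ->
  (forall K, \forall n \near \oo, (K <= N n)%N) ->
  (forall m, f n m @[n --> \oo] --> q ^+ m) ->
  C n @[n --> \oo] --> (1 : R) -> t n @[n --> \oo] --> q ->
  \sum_(m < N n) f n m @[n --> \oo] --> (1 - q)^-1.
Proof.
move=> /andP[q0 q1] dom Noo fq C1 tq.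
have cU : C n * (1 - t n)^-1 @[n --> \oo] --> (1 - q)^-1.
  rewrite -[X in _ --> X]mul1r; apply: cvgM => //; apply: cvgV.
    by rewrite subr_eq0 gt_eqF.
  by apply: cvgB => //; exact: cvg_cst.
have cL K : \sum_(m < K) f n m @[n --> \oo] --> \sum_(m < K) q ^+ m.
  elim: K => [|K IH].
    rewrite big_ord0; apply: (@cvgn_ext (fun=> 0)); last exact: cvg_cst.
    by near=> n; rewrite big_ord0.
  rewrite big_ord_recr /=.
  apply: (@cvgn_ext (fun n => \sum_(m < K) f n m + f n K)).
    by near=> n; rewrite big_ord_recr.
  exact: cvgD.
have cG : \sum_(m < K) q ^+ m @[K --> \oo] --> (1 - q)^-1.
  apply: (@cvgn_ext (fun K => (1 - q ^+ K) / (1 - q))).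
    near=> K; have -> : 1 - q ^+ K = (\sum_(m < K) q ^+ m) * (1 - q).
      by rewrite mulrC -[1 - q]opprB mulNr -subrX1 opprB.
    by rewrite mulfK // subr_eq0 gt_eqF.
  rewrite -[X in _ --> X]mul1r; apply: cvgM; last exact: cvg_cst.
  rewrite -[X in _ --> X]subr0; apply: cvgB; first exact: cvg_cst.
  by apply: cvg_expr; rewrite ger0_norm // ltW.
apply/cvgrPdist_lt => e e0.
have e2 : 0 < e / 2 by rewrite divr_gt0.
have [K hK] : exists K, (1 - q)^-1 - e / 2 < \sum_(m < K) q ^+ m.
  have /cvgrPdist_lt /(_ _ e2) [K _ /(_ K (leqnn _)) /=] := cG.
  rewrite ltr_norml => /andP[_ h]; exists K; lra.
have {}cL := cL K.
near=> n.
have hL : \sum_(m < K) q ^+ m - e / 2 < \sum_(m < K) f n m.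
  have : `|\sum_(m < K) q ^+ m - \sum_(m < K) f n m| < e / 2.
    by near: n; move/cvgrPdist_lt : cL; exact.
  rewrite ltr_norml => /andP[_ h]; lra.
have hU : C n * (1 - t n)^-1 < (1 - q)^-1 + e.
  have : `|(1 - q)^-1 - C n * (1 - t n)^-1| < e by near: n; move/cvgrPdist_lt : cU; exact.
  rewrite ltr_norml => /andP[h _]; lra.
have dn m : (m < N n)%N -> 0 <= f n m <= C n * t n ^+ m.
  by move: m; near: n.
have KN : (K <= N n)%N by near: n; exact: Noo.
have tn1 : t n < 1 by near: n; exact: (cvgr_lt _ tq).
have tn0 : 0 < t n by near: n; exact: (cvgr_gt _ tq).
have Cn0 : 0 < C n by near: n; exact: (cvgr_gt _ C1).
have lo : \sum_(m < K) f n m <= \sum_(m < N n) f n m.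
  rewrite -!(big_mkord xpredT (f n)) (big_cat_nat _ KN) //= lerDl big_nat.
  by apply: sumr_ge0 => m /andP[_ /dn /andP[]].
have hi : \sum_(m < N n) f n m <= C n * (1 - t n)^-1.
  apply: (@le_trans _ _ (C n * \sum_(m < N n) t n ^+ m)).
    by rewrite mulr_sumr; apply: ler_sum => m _; have /andP[] := dn m (ltn_ord m).
  by rewrite ler_wpM2l ?(ltW Cn0) // sum_geometric_le // (ltW tn0).
rewrite ltr_norml; apply/andP; split; lra.
Unshelve. all: by end_near. Qed.

End geometric_domination.

(** * Log-concavity of the r-Stirling numbers of the first kind *)

Section log_concavity.
Variables (R : realType) (r : R).
Hypothesis r_ge0 : 0 <= r.

Lemma rising_coef_ge0 n j : 0 <= (rising n r)`_j.
Proof.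
elim: n j => [|n IH] j; first by rewrite /rising big_ord0 coef1; case: eqP.
rewrite /rising big_ord_recr /= -/(rising n r) mulrDr coefD coefMX coefMC.
by rewrite addr_ge0 ?mulr_ge0 ?addr_ge0 //; case: ifP.
Qed.

(** The two-index form is preserved by multiplication with ['X + s] for [s >= 0], and it avoids
    quotients of coefficients that may vanish. *)
Lemma rising_log_concave n i l : (i <= l)%N ->
  (rising n r)`_i * (rising n r)`_l.+1 <= (rising n r)`_i.+1 * (rising n r)`_l.
Proof.
elim: n i l => [|n IH] i l il.
  by rewrite /rising big_ord0 !coef1 /= mulr0 mul0r.
have rc j : (rising n.+1 r)`_j = (if j == 0 then 0 else (rising n r)`_j.-1) + (rising n r)`_j * (r + n%:R).
  by rewrite /rising big_ord_recr /= -/(rising n r) mulrDr coefD coefMX coefMC.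
have s0 : 0 <= r + n%:R by rewrite addr_ge0.
set s := r + n%:R in rc s0; set a := fun j => (rising n r)`_j.
have a0 j : 0 <= a j by exact: rising_coef_ge0.
have {}IH i' l' : (i' <= l')%N -> a i' * a l'.+1 <= a i'.+1 * a l' by exact: IH.
rewrite !rc /= -!/(a _).
have h1 : s ^+ 2 * (a i * a l.+1) <= s ^+ 2 * (a i.+1 * a l) by rewrite ler_wpM2l ?sqr_ge0 ?IH.
case: i il h1 => [|i] il h1 /=.
  rewrite add0r.
  case: l il h1 => [|l] il h1 /=; first by rewrite add0r; apply: eq_ler; ring.
  have h2 : 0 <= a 0 * a l by rewrite mulr_ge0.
  have h3 : 0 <= s * (a 1 * a l) by rewrite !mulr_ge0.
  have h4 : a 0 * s * (a l.+1 + a l.+2 * s) = s * (a 0 * a l.+1) + s ^+ 2 * (a 0 * a l.+2) by ring.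
  have h5 : (a 0 + a 1 * s) * (a l + a l.+1 * s) =
    a 0 * a l + s * (a 1 * a l) + s * (a 0 * a l.+1) + s ^+ 2 * (a 1 * a l.+1) by ring.
  rewrite h4 h5; lra.
case: l il h1 => [//|l] il h1 /=.
have h2 := IH i l il.
(* Both indices move by two, hence two uses of the induction hypothesis; for [i = l] the two sides
   agree. *)
have h3 : s * (a i * a l.+2) <= s * (a i.+2 * a l).
  rewrite ler_wpM2l //.
  move: il; rewrite ltnS leq_eqVlt => /predU1P[->|il]; first by rewrite mulrC.
  apply: (@le_trans _ _ (a i.+1 * a l.+1)); first by apply: IH; lia.
  by apply: IH.
have h4 : (a i + a i.+1 * s) * (a l.+1 + a l.+2 * s) =
  a i * a l.+1 + s * (a i * a l.+2) + s * (a i.+1 * a l.+1) + s ^+ 2 * (a i.+1 * a l.+2) by ring.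
have h5 : (a i.+1 + a i.+2 * s) * (a l + a l.+1 * s) =
  a i.+1 * a l + s * (a i.+2 * a l) + s * (a i.+1 * a l.+1) + s ^+ 2 * (a i.+2 * a l.+1) by ring.
rewrite h4 h5; lra.
Qed.

Lemma rising_coef_geo_up n j m : 0 < (rising n r)`_j ->
  (rising n r)`_(j + m) <= (rising n r)`_j * ((rising n r)`_j.+1 / (rising n r)`_j) ^+ m.
Proof.
set a := fun j => (rising n r)`_j; rewrite -!/(a _) => aj.
elim: m => [|m IH]; first by rewrite addn0 expr0 mulr1.
rewrite addnS exprSr mulrA.
apply: (@le_trans _ _ (a (j + m)%N * (a j.+1 / a j))); last first.
  by rewrite ler_wpM2r // divr_ge0 ?(ltW aj) // rising_coef_ge0.
rewrite mulrA ler_pdivlMr // mulrC [leRHS]mulrC.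
by apply: rising_log_concave; exact: leq_addr.
Qed.

Lemma rising_coef_geo_down n j m : 0 < (rising n r)`_j -> (m <= j)%N ->
  (rising n r)`_(j - m) <= (rising n r)`_j * ((rising n r)`_j.-1 / (rising n r)`_j) ^+ m.
Proof.
set a := fun j => (rising n r)`_j; rewrite -!/(a _) => aj.
elim: m => [|m IH] mj; first by rewrite subn0 expr0 mulr1.
rewrite exprSr mulrA.
apply: (@le_trans _ _ (a (j - m)%N * (a j.-1 / a j))); last first.
  by rewrite ler_wpM2r ?IH ?(ltnW mj) // divr_ge0 ?(ltW aj) // rising_coef_ge0.
rewrite mulrA ler_pdivlMr //.
have := @rising_log_concave n (j - m.+1)%N j.-1.
rewrite (ltn_predK mj) subnSK //; apply; lia.
Qed.

End log_concavity.

(** * Limits of the coefficients along indices [J n] of order [ln n] *)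

Section rising_asymptotics.
Variables (R : realType) (r : R).
Hypothesis r_ge0 : 0 <= r.

Definition coef_quot n j : R :=
  (rising n r)`_j * j`!%:R / (normalizer r n * ln n%:R ^+ j).

Lemma cvgn_lnn : ln n%:R @[n --> \oo] --> (+oo : set_system R).
Proof. exact/cvgn_ln_pinfty/cvgn_natr. Qed.

Lemma cvgn_lnnV : (ln n%:R)^-1 @[n --> \oo] --> (0 : R).
Proof.
apply/gtr0_cvgV0; last exact: cvgn_lnn.
exact: (cvgry_gt cvgn_lnn).
Qed.

Variables (J : nat -> nat) (y : R).
Hypotheses (y_gt0 : 0 < y) (Jy : (J n)%:R / ln n%:R @[n --> \oo] --> y).

Lemma cvg_Jpinfty : (J n)%:R @[n --> \oo] --> (+oo : set_system R).
Proof.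
apply/cvgryPge => A; near=> n.
have L0 : 0 < ln n%:R :> R by near: n; exact: (cvgry_gt cvgn_lnn).
have h1 : y / 2 <= (J n)%:R / ln n%:R.
  by near: n; apply: (cvgr_ge _ Jy); rewrite ltr_pdivrMr // ltr_pMr // ltr1n.
have h2 : A / (y / 2) <= ln n%:R by near: n; exact: (cvgry_ge cvgn_lnn).
move: h1; rewrite ler_pdivlMr // => h1; apply: le_trans h1.
by rewrite mulrC -ler_pdivrMr // divr_gt0.
Unshelve. all: by end_near. Qed.

Lemma near_J_gt K : \forall n \near \oo, (K < J n)%N.
Proof. by near=> n; rewrite -(ltr_nat R); near: n; exact: (cvgry_gt cvg_Jpinfty). Unshelve. all: by end_near. Qed.

(** Leaves room for any fixed number of terms of the upper tail. The quotient [ln n / n] vanishes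
    since [ln n = 2 ln (sqrt n) < 2 sqrt n]. *)
Lemma near_J_lt K : \forall n \near \oo, (J n + K < n)%N.
Proof.
have c : ((J n)%:R / ln n%:R + K%:R / ln n%:R) * (ln n%:R / n%:R) @[n --> \oo] --> (y + K%:R * 0) * 0.
  apply: cvgM.
    by apply: cvgD => //; apply: cvgM; [exact: cvg_cst|exact: cvgn_lnnV].
  have h2 : (2 : R) * n%:R `^ (- 2^-1) @[n --> \oo] --> (2 * 0 : R).
    apply: cvgM; first exact: cvg_cst.
    by apply: cvg_powRN; [rewrite invr_gt0|exact: cvgn_natr].
  apply: (@squeeze_cvgr _ _ _ _ (cst 0) (fun n => 2 * n%:R `^ (- 2^-1))); last 2 first.
  - exact: cvg_cst.
  - by rewrite mulr0 in h2.
  near=> n; have n0 : (0 < n)%N by near: n; exact: nbhs_infty_gt.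
  have nR : 0 < n%:R :> R by rewrite ltr0n.
  rewrite divr_ge0 ?ln_ge0 ?ler1n //= ler_pdivrMr //.
  have -> : 2 * n%:R `^ (- 2^-1) * n%:R = 2 * n%:R `^ (2^-1) :> R.
    rewrite -mulrA; congr (_ * _).
    rewrite -[X in _ * X = _]powRr1 ?(ltW nR) // -powRD ?(gt_eqF nR) ?implybT //.
    by congr powR; field.
  have -> : ln n%:R = 2 * ln (n%:R `^ 2^-1) :> R by rewrite ln_powR; field.
  by rewrite ler_wpM2l // ltW // ln_sublinear // powR_gt0.
near=> n; have n1 : (1 < n)%N by near: n; exact: nbhs_infty_gt.
have nR : 0 < n%:R :> R by rewrite ltr0n ltnW.
have L0 : 0 < ln n%:R :> R by rewrite ln_gt0 // ltr1n.
have : ((J n)%:R / ln n%:R + K%:R / ln n%:R) * (ln n%:R / n%:R) < 1 :> R.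
  by near: n; apply: (cvgr_lt _ c); rewrite mulr0.
rewrite -(ltr_nat R) natrD.
have -> : ((J n)%:R / ln n%:R + K%:R / ln n%:R) * (ln n%:R / n%:R) = ((J n)%:R + K%:R) / n%:R :> R.
  by field; rewrite !gt_eqF.
by rewrite ltr_pdivrMr // mul1r.
Unshelve. all: by end_near. Qed.

Lemma cvg_J_add K : (J n + K)%:R / ln n%:R @[n --> \oo] --> y.
Proof.
rewrite -[X in _ --> X]addr0 -(mulr0 K%:R).
apply: (@cvgn_ext _ (fun n => (J n)%:R / ln n%:R + K%:R * (ln n%:R)^-1)).
  by near=> n; rewrite natrD mulrDl.
by apply: cvgD => //; apply: cvgM; [exact: cvg_cst|exact: cvgn_lnnV].
Unshelve. all: by end_near. Qed.

Lemma cvg_J_sub K : (J n - K)%:R / ln n%:R @[n --> \oo] --> y.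
Proof.
rewrite -[X in _ --> X]subr0 -(mulr0 K%:R).
apply: (@cvgn_ext _ (fun n => (J n)%:R / ln n%:R - K%:R * (ln n%:R)^-1)).
  near=> n; have h : (K < J n)%N by near: n; exact: near_J_gt.
  by rewrite natrB ?mulrBl // ltnW.
by apply: cvgB => //; apply: cvgM; [exact: cvg_cst|exact: cvgn_lnnV].
Unshelve. all: by end_near. Qed.

Lemma cvg_coef_quot : coef_quot n (J n) @[n --> \oo] --> (Gamma (y + r))^-1.
Proof.
pose Y := y + 1; have Y1 : 1 <= Y by rewrite lerDr ltW.
have [C C0 HC] := rising_coef_bound r_ge0 Y1.
have yr0 : 0 < y + r by rewrite ltr_wpDr.
have cg := cvg_gauss_quot yr0.
have cd : C * ((J n)%:R^-1 + `|(J n)%:R / ln n%:R - y|) @[n --> \oo] --> 0.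
  rewrite -[X in _ --> X](mulr0 C); apply: cvgM; first exact: cvg_cst.
  rewrite -[X in _ --> X]addr0; apply: cvgD.
    apply/gtr0_cvgV0; last exact: cvg_Jpinfty.
    exact: (cvgry_gt cvg_Jpinfty).
  rewrite -[X in _ --> X](@normr0 _ R); apply: cvg_norm.
  by rewrite -[X in _ --> X](subrr y); apply: cvgB => //; exact: cvg_cst.
have cz : coef_quot n (J n) - gauss_quot (y + r) n @[n --> \oo] --> 0.
  apply: norm_cvg0.
  apply: (squeeze_cvgr _ (cvg_cst 0) cd); near=> n; rewrite normr_ge0 /=.
  apply: HC; last 1 first.
  - by near: n; apply: (cvgr_le _ Jy); rewrite ltrDl.
  - by near: n; exact: nbhs_infty_gt.
  - by near: n; exact: near_J_gt.
  - by apply/andP; split; [exact: ltW|rewrite /Y lerDl ler01].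
apply: (@cvgn_ext _ (fun n => coef_quot n (J n) - gauss_quot (y + r) n + gauss_quot (y + r) n)).
  by near=> n; rewrite subrK.
by rewrite -[X in _ --> X]add0r; exact: cvgD.
Unshelve. all: by end_near. Qed.

Lemma near_coef_gt0 : \forall n \near \oo, 0 < (rising n r)`_(J n).
Proof.
near=> n; rewrite lt_neqAle rising_coef_ge0 // andbT eq_sym.
apply: contraTN (_ : 0 < coef_quot n (J n)); last first.
  near: n; apply: (cvgr_gt _ cvg_coef_quot).
  by rewrite invr_gt0 Gamma_gt0 // ltr_wpDr.
by move=> /eqP h; rewrite /coef_quot h !mul0r ltxx.
Unshelve. all: by end_near. Qed.

End rising_asymptotics.

Section coefficient_ratios.
Variables (R : realType) (r : R).
Hypothesis r_ge0 : 0 <= r.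
Variables (J : nat -> nat) (y : R).
Hypotheses (y_gt0 : 0 < y) (Jy : (J n)%:R / ln n%:R @[n --> \oo] --> y).

(** Indices [J n] and [J n + 1] have the same limit after division by [ln n], so the Gamma factors
    cancel and the ratio of Poisson weights remains. *)
Lemma cvg_coef_succ :
  (rising n r)`_(J n).+1 / (rising n r)`_(J n) @[n --> \oo] --> y^-1.
Proof.
have G0 : 0 < Gamma (y + r) by rewrite Gamma_gt0 // ltr_wpDr.
have J1 := cvg_J_add Jy 1.
have : (coef_quot r n (J n + 1)%N / coef_quot r n (J n)) / ((J n + 1)%:R / ln n%:R) @[n --> \oo] -->
  ((Gamma (y + r))^-1 / (Gamma (y + r))^-1) / y.
  apply: cvgM; last by apply: cvgV => //; rewrite gt_eqF.
  apply: cvgM; first exact: cvg_coef_quot.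
  apply: cvgV; last exact: cvg_coef_quot.
  by rewrite invr_neq0 // gt_eqF.
rewrite divff ?invr_neq0 ?gt_eqF // mul1r => h; apply: cvgn_ext h; near=> n.
have n1 : (1 < n)%N by near: n; exact: nbhs_infty_gt.
have a0 : 0 < (rising n r)`_(J n) by near: n; exact: near_coef_gt0 Jy.
have L0 : 0 < ln n%:R :> R by rewrite ln_gt0 // ltr1n.
have N0 : 0 < normalizer r n by rewrite normalizer_gt0 // ltnW.
rewrite /coef_quot addn1 factS natrM exprSr.
have f0 : (J n)`!%:R != 0 :> R by rewrite pnatr_eq0 -lt0n fact_gt0.
have s0 : (J n).+1%:R != 0 :> R by rewrite pnatr_eq0.
have p0 : ln n%:R ^+ J n != 0 :> R by rewrite expf_eq0 gt_eqF // andbF.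
by move: ((J n).+1%:R : R) s0 => s s0; field; rewrite f0 s0 p0 !gt_eqF.
Unshelve. all: by end_near. Qed.

End coefficient_ratios.

(** * The r-Lah distribution *)

Section rlah_distribution.
Variables (R : realType) (k : nat) (r : R).
Hypothesis r_ge0 : 0 <= r.
Local Notation c := (k%:R + r).
Hypothesis c_gt0 : 0 < c.

(** The factor [k!] cancels in the probabilities and makes the weight asymptotic to [c ^+ j] with
    constant [1]. *)
Definition stir2w j : R := k`!%:R * rstirling2 j k r.

Lemma stir2w_ge0 j : 0 <= stir2w j.
Proof. by rewrite mulr_ge0 // rstirling2_ge0. Qed.

Lemma stir2w_le j : stir2w j <= c ^+ j.
Proof. exact: rstirling2_upper. Qed.

Lemma stir2w_lower j : c ^+ j - k%:R * (c - 1) ^+ j <= stir2w j.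
Proof.
rewrite /stir2w; case: (k) => [|m].
  by rewrite mul0r subr0 add0r rstirling2_0 // mul1r.
have -> : m.+1%:R + r - 1 = m%:R + r by rewrite -natr1; ring.
exact: rstirling2_lower.
Qed.

Lemma stir2w_small j : (j < k)%N -> stir2w j = 0.
Proof. by move=> jk; rewrite /stir2w /rstirling2 big_geq // mulr0. Qed.

Lemma cvg_stir2w : stir2w j / c ^+ j @[j --> \oo] --> (1 : R).
Proof.
apply: (@squeeze_cvgr _ _ _ _ (fun j => 1 - k%:R * ((c - 1) / c) ^+ j) (cst 1)); last 2 first.
- rewrite -[X in _ --> X]subr0; apply: cvgB; first exact: cvg_cst.
  (* For [k = 0] the ratio [(c - 1) / c] may lie outside the unit interval, but its prefactor is
     zero; for [k > 0] one has [c >= 1]. *)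
  case: (posnP k) => [->|k0].
    apply: (@cvgn_ext _ (fun=> 0)); last exact: cvg_cst.
    by near=> n; rewrite mul0r.
  rewrite -[X in _ --> X](mulr0 k%:R); apply: cvgM; first exact: cvg_cst.
  have k1 : 1 <= k%:R :> R by rewrite ler1n.
  apply: cvg_expr; rewrite ger0_norm ?ltr_pdivrMr //; first by rewrite mul1r gtrBl.
  by rewrite divr_ge0 ?(ltW c_gt0) //; move: r_ge0; lra.
- exact: cvg_cst.
near=> j; have cj : 0 < c ^+ j by rewrite exprn_gt0.
apply/andP; split; last by rewrite ler_pdivrMr // mul1r stir2w_le.
rewrite ler_pdivlMr // expr_div_n; apply: le_trans (stir2w_lower j).
by apply: eq_ler; field; rewrite gt_eqF.
Unshelve. all: by end_near. Qed.

Definition lahZ n : R := \sum_(k <= j < n.+1) (rising n r)`_j * stir2w j.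

Lemma lahZE n : lahZ n = k`!%:R * rlah n k r.
Proof.
rewrite /lahZ /rlah mulr_sumr; apply: eq_bigr => j _.
by rewrite rstirling1E /stir2w; ring.
Qed.

Definition lah_pmf n j : R := (rlah n k r)^-1 * (rstirling1 n j r * rstirling2 j k r).

Lemma lah_pmfE n j : lah_pmf n j = (rising n r)`_j * stir2w j / lahZ n.
Proof.
rewrite /lah_pmf lahZE /stir2w rstirling1E invfM.
have f0 : k`!%:R != 0 :> R by rewrite pnatr_eq0 -lt0n fact_gt0.
by rewrite [k`!%:R^-1 * _]mulrC; set Q := (rlah _ _ _)^-1; field.
Qed.

Lemma lahZ_ord n : (k <= n)%N -> lahZ n = \sum_(j < n.+1) (rising n r)`_j * stir2w j.
Proof.
move=> kn; rewrite /lahZ -(big_mkord xpredT (fun j => (rising n r)`_j * stir2w j)).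
rewrite [RHS](@big_cat_nat _ _ _ k) //=; last exact: leqW.
rewrite [X in _ = X + _]big_nat [X in _ = X + _]big1 ?add0r // => j /andP[_ jk].
by rewrite stir2w_small // mulr0.
Qed.

Lemma rising_horner n (v : R) : (rising n r).[v] = \prod_(i < n) (v + r + i%:R).
Proof.
by rewrite /rising horner_prod; apply: eq_bigr => i _; rewrite hornerD hornerX hornerC addrA.
Qed.

Lemma size_rising n : size (rising n r) = n.+1.
Proof.
elim: n => [|n IH]; first by rewrite /rising big_ord0 size_poly1.
rewrite /rising big_ord_recr /= -/(rising n r) size_Mmonic ?monicXaddC //.
  by rewrite size_XaddC IH addn2.
by rewrite -size_poly_eq0 IH.
Qed.

Lemma rising_horner_coef n (v : R) : (rising n r).[v] = \sum_(j < n.+1) (rising n r)`_j * v ^+ j.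
Proof. by rewrite horner_coef size_rising. Qed.

(** The bounds on [stir2w] evaluate the rising polynomial at [c] and at [c - 1]. The second value
    telescopes to the fraction [(c + r - 1) / (c + r - 1 + n)] of the first, hence is negligible. *)
Lemma cvg_lahZ : lahZ n / \prod_(i < n) (c + r + i%:R) @[n --> \oo] --> (1 : R).
Proof.
have cr0 : 0 < c + r by rewrite ltr_wpDr.
apply: (@squeeze_cvgr _ _ _ _
  (fun n => 1 - k%:R * ((c + r - 1) * (c + r - 1 + n%:R)^-1)) (cst 1)); last 2 first.
- rewrite -[X in _ --> X]subr0; apply: cvgB; first exact: cvg_cst.
  rewrite -[X in _ --> X](mulr0 k%:R); apply: cvgM; first exact: cvg_cst.
  rewrite -[X in _ --> X](mulr0 (c + r - 1)); apply: cvgM; first exact: cvg_cst.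
  have cy : c + r - 1 + n%:R @[n --> \oo] --> (+oo : set_system R).
    apply/cvgryPge => A; near=> n; rewrite addrC -lerBlDr.
    by near: n; exact: nbhs_infty_ger.
  apply/gtr0_cvgV0; last exact: cy.
  exact: (cvgry_gt cy).
- exact: cvg_cst.
near=> n.
have kn : (k <= n)%N by near: n; exact: nbhs_infty_ge.
have n1 : (1 < n)%N by near: n; exact: nbhs_infty_gt.
have P0 : 0 < \prod_(i < n) (c + r + i%:R) by apply: prodr_gt0 => i _; rewrite ltr_wpDr.
have n1R : 1 < n%:R :> R by rewrite ltr1n.
have d0 : 0 < c + r - 1 + n%:R by lra.
rewrite lahZ_ord //; apply/andP; split; last first.
  rewrite ler_pdivrMr // mul1r -rising_horner rising_horner_coef; apply: ler_sum => j _.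
  by rewrite ler_wpM2l ?rising_coef_ge0 // stir2w_le.
rewrite ler_pdivlMr // mulrBl mul1r -mulrA.
have -> : (c + r - 1) / (c + r - 1 + n%:R) * \prod_(i < n) (c + r + i%:R) = \prod_(i < n) (c - 1 + r + i%:R).
  have -> : c - 1 + r = c + r - 1 by ring.
  (* Stated without division, as [c + r - 1] may vanish. *)
  have shift z m : \prod_(i < m) (z + 1 + i%:R) * z = \prod_(i < m) (z + i%:R) * (z + m%:R) :> R.
    elim: m => [|m IH]; first by rewrite !big_ord0 addr0.
    by rewrite !big_ord_recr /= mulrAC IH -natr1; ring.
  have := shift (c + r - 1) n; rewrite subrK => h.
  apply: (@mulIf _ (c + r - 1 + n%:R)); first by rewrite gt_eqF.
  by rewrite -h; field; rewrite gt_eqF.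
rewrite -!rising_horner !rising_horner_coef mulr_sumr -sumrB; apply: ler_sum => j _.
apply: le_trans (ler_wpM2l (rising_coef_ge0 r_ge0 n j) (stir2w_lower j)).
by apply: eq_ler; ring.
Unshelve. all: by end_near. Qed.

Variables (J : nat -> nat) (x : R).
Hypotheses (x_gt0 : 0 < x) (Jx : (J n)%:R / ln n%:R @[n --> \oo] --> c * x).

Let cx_gt0 : 0 < c * x. Proof. by rewrite mulr_gt0. Qed.

Lemma cvg_comp_stir2w (K : nat -> nat) : (K n)%:R @[n --> \oo] --> (+oo : set_system R) ->
  stir2w (K n) / c ^+ K n @[n --> \oo] --> (1 : R).
Proof.
move=> Ky; apply: (@cvg_comp _ _ _ K (fun j => stir2w j / c ^+ j) _ \oo); last exact: cvg_stir2w.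
move=> A [m _ hm]; apply: filterS (cvgry_ge Ky m%:R) => n.
by rewrite ler_nat => h; apply: hm.
Qed.

Let term n j : R := (rising n r)`_j * stir2w j.

Let term_ge0 n j : 0 <= term n j.
Proof. by apply: mulr_ge0; [exact: rising_coef_ge0|exact: stir2w_ge0]. Qed.

(** The ratio of coefficients is a product of [m] consecutive ratios, each tending to [1 / (c x)];
    the second-kind weights contribute [c ^+ m]. *)
Lemma cvg_term_up m : term n (J n + m) / term n (J n) @[n --> \oo] --> x^-1 ^+ m.
Proof.
have cJ i := cvg_comp_stir2w (cvg_Jpinfty cx_gt0 (cvg_J_add Jx i)).
have cJ0 := cvg_comp_stir2w (cvg_Jpinfty cx_gt0 Jx).
have cr i : (rising n r)`_(J n + i) / (rising n r)`_(J n) @[n --> \oo] --> (c * x)^-1 ^+ i.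
  elim: i => [|i IH].
    rewrite expr0; apply: (@cvgn_ext _ (fun=> 1)); last exact: cvg_cst.
    near=> n; have h : 0 < (rising n r)`_(J n) by near: n; exact: near_coef_gt0 Jx.
    by rewrite addn0 divff // gt_eqF.
  rewrite exprSr; apply: (@cvgn_ext _ (fun n => (rising n r)`_(J n + i) / (rising n r)`_(J n) *
      ((rising n r)`_(J n + i).+1 / (rising n r)`_(J n + i)))); last first.
    by apply: cvgM => //; exact: (cvg_coef_succ r_ge0 cx_gt0 (cvg_J_add Jx i)).
  near=> n.
  have h : 0 < (rising n r)`_(J n + i) by near: n; exact: near_coef_gt0 (cvg_J_add Jx i).
  by rewrite addnS mulrC mulrA divfK // gt_eqF.
have : (rising n r)`_(J n + m) / (rising n r)`_(J n) *
   ((stir2w (J n + m) / c ^+ (J n + m)) / (stir2w (J n) / c ^+ (J n)) * c ^+ m) @[n --> \oo] -->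
   (c * x)^-1 ^+ m * (1 / 1 * c ^+ m).
  apply: cvgM => //; apply: cvgM; last exact: cvg_cst.
  by apply: cvgM => //; apply: cvgV => //; exact: oner_neq0.
have -> : (c * x)^-1 ^+ m * (1 / 1 * c ^+ m) = x^-1 ^+ m.
  by rewrite divr1 mul1r -exprMn; congr (_ ^+ _); field; rewrite !gt_eqF.
move=> h; apply: cvgn_ext h; near=> n.
have a0 : 0 < (rising n r)`_(J n) by near: n; exact: near_coef_gt0 Jx.
have w0 : 0 < stir2w (J n) / c ^+ J n by near: n; exact: (cvgr_gt _ cJ0).
have cn0 i : c ^+ i != 0 by rewrite expf_eq0 gt_eqF // andbF.
have {}w0 : stir2w (J n) != 0.
  by apply: contraTneq w0 => ->; rewrite mul0r ltxx.
rewrite /term exprD; field.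
by rewrite w0 !cn0 gt_eqF.
Unshelve. all: by end_near. Qed.

Lemma cvg_term_down m : term n (J n - m) / term n (J n) @[n --> \oo] --> x ^+ m.
Proof.
have cJ i := cvg_comp_stir2w (cvg_Jpinfty cx_gt0 (cvg_J_sub cx_gt0 Jx i)).
have cJ0 := cvg_comp_stir2w (cvg_Jpinfty cx_gt0 Jx).
have cr i : (rising n r)`_(J n - i) / (rising n r)`_(J n) @[n --> \oo] --> (c * x) ^+ i.
  elim: i => [|i IH].
    rewrite expr0; apply: (@cvgn_ext _ (fun=> 1)); last exact: cvg_cst.
    near=> n; have h : 0 < (rising n r)`_(J n) by near: n; exact: near_coef_gt0 Jx.
    by rewrite subn0 divff // gt_eqF.
  (* A step down is the inverse of a step up from [J n - i.+1]; truncated subtraction is harmless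
     because [J n] eventually exceeds [i]. *)
  have s := cvg_coef_succ r_ge0 cx_gt0 (cvg_J_sub cx_gt0 Jx i.+1).
  rewrite exprSr; apply: (@cvgn_ext _ (fun n => (rising n r)`_(J n - i) / (rising n r)`_(J n) *
      ((rising n r)`_(J n - i.+1).+1 / (rising n r)`_(J n - i.+1))^-1)); last first.
    by apply: cvgM => //; rewrite -[X in _ --> X]invrK; apply: cvgV => //; rewrite invr_neq0 // gt_eqF.
  near=> n.
  have h : 0 < (rising n r)`_(J n - i) by near: n; exact: near_coef_gt0 (cvg_J_sub cx_gt0 Jx i).
  have iJ : (i < J n)%N by near: n; exact: near_J_gt Jx _.
  rewrite subnSK // invf_div mulrC mulrA divfK // gt_eqF //.
have : (rising n r)`_(J n - m) / (rising n r)`_(J n) *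
   ((stir2w (J n - m) / c ^+ (J n - m)) / (stir2w (J n) / c ^+ (J n)) / c ^+ m) @[n --> \oo] -->
   (c * x) ^+ m * (1 / 1 / c ^+ m).
  apply: cvgM => //; apply: cvgM; last exact: cvg_cst.
  by apply: cvgM => //; apply: cvgV => //; exact: oner_neq0.
have cn0 i : c ^+ i != 0 by rewrite expf_eq0 gt_eqF // andbF.
have -> : (c * x) ^+ m * (1 / 1 / c ^+ m) = x ^+ m.
  by rewrite exprMn; field.
move=> h; apply: cvgn_ext h; near=> n.
have a0 : 0 < (rising n r)`_(J n) by near: n; exact: near_coef_gt0 Jx.
have w0 : 0 < stir2w (J n) / c ^+ J n by near: n; exact: (cvgr_gt _ cJ0).
have {}w0 : stir2w (J n) != 0.
  by apply: contraTneq w0 => ->; rewrite mul0r ltxx.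
have mJ : (m < J n)%N by near: n; exact: near_J_gt Jx _.
have -> : c ^+ J n = c ^+ (J n - m) * c ^+ m by rewrite -exprD subnK // ltnW.
rewrite /term; field.
by rewrite w0 !cn0 gt_eqF.
Unshelve. all: by end_near. Qed.

Lemma near_term_gt0 : \forall n \near \oo, 0 < term n (J n).
Proof.
have cJ0 := cvg_comp_stir2w (cvg_Jpinfty cx_gt0 Jx).
near=> n.
have a0 : 0 < (rising n r)`_(J n) by near: n; exact: near_coef_gt0 Jx.
rewrite /term mulr_gt0 // lt_neqAle stir2w_ge0 andbT eq_sym.
have : 0 < stir2w (J n) / c ^+ J n by near: n; exact: (cvgr_gt _ cJ0).
by apply: contraTneq => ->; rewrite mul0r ltxx.
Unshelve. all: by end_near. Qed.

(** Log-concavity bounds the first-kind factor and [stir2w j <= c ^+ j] the second. The only loss is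
    at the base point, the constant [c ^+ J n / stir2w (J n)], which tends to [1]. *)
Lemma cvg_upper_tail : 1 < x ->
  (\sum_(J n <= j < n.+1) lah_pmf n j) / lah_pmf n (J n) @[n --> \oo] --> x / (x - 1).
Proof.
move=> x1.
have -> : x / (x - 1) = (1 - x^-1)^-1 by field; rewrite !gt_eqF //; lra.
have cJ0 := cvg_comp_stir2w (cvg_Jpinfty cx_gt0 Jx).
have := @cvg_sum_geometric R (fun n m => term n (J n + m) / term n (J n))
  (fun n => (n.+1 - J n)%N) (fun n => (stir2w (J n) / c ^+ J n)^-1)
  (fun n => (rising n r)`_(J n).+1 / (rising n r)`_(J n) * c) x^-1.
move=> H; apply: cvgn_ext (H _ _ _ cvg_term_up _ _) => {H}.
- near=> n.
  have t0 : 0 < term n (J n) by near: n; exact: near_term_gt0.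
  have Z0 : 0 < lahZ n.
    have : 0 < lahZ n / \prod_(i < n) (c + r + i%:R) by near: n; exact: (cvgr_gt _ cvg_lahZ).
    rewrite pmulr_lgt0 // invr_gt0; apply: prodr_gt0 => i _.
    by rewrite ltr_wpDr // ltr_wpDr.
  rewrite -[J n in RHS]add0n big_addn big_mkord.
  rewrite !mulr_suml; apply: eq_bigr => m _; rewrite !lah_pmfE addnC.
  rewrite -/(term _ _) -/(term _ _); field.
  by rewrite !gt_eqF.
- by rewrite invr_gt0 x_gt0 invf_lt1.
- near=> n => m _.
  have a0 : 0 < (rising n r)`_(J n) by near: n; exact: near_coef_gt0 Jx.
  have t0 : 0 < term n (J n) by near: n; exact: near_term_gt0.
  have w0 : 0 < stir2w (J n) by move: t0; rewrite /term pmulr_rgt0.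
  apply/andP; split; first by rewrite divr_ge0 ?term_ge0.
  rewrite ler_pdivrMr //.
  have h := rising_coef_geo_up r_ge0 m a0.
  apply: le_trans (ler_pM (rising_coef_ge0 r_ge0 _ _) (stir2w_ge0 _) h (stir2w_le _)) _.
  have cn0 i : c ^+ i != 0 by rewrite expf_eq0 gt_eqF // andbF.
  rewrite /term exprD (exprMn _ _ c); apply: eq_ler.
  by move: ((_ / _) ^+ m) => q; field; rewrite cn0 gt_eqF.
- move=> K; near=> n.
  have : (J n + K < n)%N by near: n; exact: near_J_lt Jx _.
  by lia.
- by rewrite -[X in _ --> X]invr1; apply: cvgV => //; exact: oner_neq0.
- have -> : x^-1 = (c * x)^-1 * c by field; rewrite !gt_eqF.
  by apply: cvgM; [exact: cvg_coef_succ|exact: cvg_cst].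
Unshelve. all: by end_near. Qed.

Lemma cvg_lower_tail : x < 1 ->
  (\sum_(k <= j < (J n).+1) lah_pmf n j) / lah_pmf n (J n) @[n --> \oo] --> 1 / (1 - x).
Proof.
move=> x1; rewrite div1r.
have cJ0 := cvg_comp_stir2w (cvg_Jpinfty cx_gt0 Jx).
have := @cvg_sum_geometric R (fun n m => term n (J n - m) / term n (J n))
  (fun n => ((J n).+1 - k)%N) (fun n => (stir2w (J n) / c ^+ J n)^-1)
  (fun n => (rising n r)`_(J n).-1 / (rising n r)`_(J n) / c) x.
move=> H; apply: cvgn_ext (H _ _ _ cvg_term_down _ _) => {H}.
- near=> n.
  have t0 : 0 < term n (J n) by near: n; exact: near_term_gt0.
  have Z0 : 0 < lahZ n.
    have : 0 < lahZ n / \prod_(i < n) (c + r + i%:R) by near: n; exact: (cvgr_gt _ cvg_lahZ).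
    rewrite pmulr_lgt0 // invr_gt0; apply: prodr_gt0 => i _.
    by rewrite ltr_wpDr // ltr_wpDr.
  have kJ : (k < J n)%N by near: n; exact: near_J_gt Jx _.
  rewrite -[k in RHS]add0n big_addn big_mkord.
  (* The sum is reversed so that [m] counts downwards from [J n]. *)
  rewrite !mulr_suml (reindex_inj rev_ord_inj) /=; apply: eq_bigr => m _; rewrite !lah_pmfE.
  have -> : (J n - ((J n).+1 - k - m.+1))%N = (m + k)%N.
    by have := ltn_ord m; lia.
  rewrite -/(term _ _) -/(term _ _); field.
  by rewrite !gt_eqF.
- by rewrite x_gt0.
- near=> n => m mk.
  have a0 : 0 < (rising n r)`_(J n) by near: n; exact: near_coef_gt0 Jx.
  have t0 : 0 < term n (J n) by near: n; exact: near_term_gt0.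
  have w0 : 0 < stir2w (J n) by move: t0; rewrite /term pmulr_rgt0.
  have mJ : (m <= J n)%N by move: mk; lia.
  apply/andP; split; first by rewrite divr_ge0 ?term_ge0.
  rewrite ler_pdivrMr //.
  have h := rising_coef_geo_down r_ge0 a0 mJ.
  apply: le_trans (ler_pM (rising_coef_ge0 r_ge0 _ _) (stir2w_ge0 _) h (stir2w_le _)) _.
  have cn0 i : c ^+ i != 0 by rewrite expf_eq0 gt_eqF // andbF.
  have cE : c ^+ J n = c ^+ (J n - m) * c ^+ m by rewrite -exprD subnK.
  rewrite /term (exprMn _ _ c^-1) exprVn cE; apply: eq_ler.
  by move: ((_ / _) ^+ m) => q; field; rewrite !cn0 !gt_eqF.
- move=> K; near=> n.
  have : (K + k < J n)%N by near: n; exact: near_J_gt Jx _.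
  by lia.
- by rewrite -[X in _ --> X]invr1; apply: cvgV => //; exact: oner_neq0.
- have -> : x = (c * x)^-1^-1 / c by field; rewrite !gt_eqF.
  apply: cvgM; last exact: cvg_cst.
  have s := cvg_coef_succ r_ge0 cx_gt0 (cvg_J_sub cx_gt0 Jx 1).
  apply: (@cvgn_ext _ (fun n => ((rising n r)`_(J n - 1).+1 / (rising n r)`_(J n - 1))^-1)); last first.
    by apply: cvgV => //; rewrite invr_neq0 // gt_eqF.
  near=> n.
  have iJ : (0 < J n)%N by near: n; exact: near_J_gt Jx _.
  by rewrite subnSK // subn0 invf_div subn1.
Unshelve. all: by end_near. Qed.

End rlah_distribution.

(** * Asymptotics of the point probabilities *)

Section pmf_asymptotics.
Variables (R : realType) (k : nat) (r : R).
Hypothesis r_ge0 : 0 <= r.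
Local Notation c := (k%:R + r).
Hypothesis c_gt0 : 0 < c.
Variables (J : nat -> nat) (x_ : nat -> R) (x : R).
Hypotheses (x_gt0 : 0 < x) (x_cvg : x_ n @[n --> \oo] --> x).
Hypothesis Jx : \forall n \near \oo, (J n)%:R = c * x_ n * ln n%:R.

Lemma cvg_J_div_ln : (J n)%:R / ln n%:R @[n --> \oo] --> c * x.
Proof.
apply: (@cvgn_ext _ (fun n => c * x_ n)).
  near=> n; have -> : (J n)%:R = c * x_ n * ln n%:R by near: n.
  rewrite mulfK // gt_eqF // ln_gt0 // ltr1n.
  by near: n; exact: nbhs_infty_gt.
by apply: cvgM => //; exact: cvg_cst.
Unshelve. all: by end_near. Qed.

Lemma cvg_lah_pmf :
  asymp_equiv (fun n => lah_pmf k r n (J n))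
    (fun n => n%:R `^ (- (c * (x_ n * ln (x_ n) - x_ n + 1)))
       / Num.sqrt (2 * pi * c * x * ln n%:R)
       * (Gamma (k%:R + 2 * r) / Gamma (c * x + r))).
Proof.
have cx_gt0 : 0 < c * x by rewrite mulr_gt0.
have cr_gt0 : 0 < c + r by rewrite ltr_wpDr.
have -> : k%:R + 2 * r = c + r by ring.
have G1 : 0 < Gamma (c * x + r) by rewrite Gamma_gt0 // ltr_wpDr.
have G2 : 0 < Gamma (c + r) by rewrite Gamma_gt0.
have Jl := cvg_J_div_ln.
have Jy := cvg_Jpinfty cx_gt0 Jl.
have s2p : 0 < Num.sqrt (2 * pi) :> R by rewrite sqrtr_gt0 mulr_gt0 // pi_gt0.
have c1 := cvg_coef_quot r_ge0 cx_gt0 Jl.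
have c2 := cvg_comp_stir2w r_ge0 c_gt0 Jy.
have c3 := cvg_lahZ r_ge0 c_gt0.
have c4 := cvg_gauss_quot cr_gt0.
have c5 : stirling_quot R (J n) @[n --> \oo] --> Num.sqrt (2 * pi).
  apply: (@cvg_comp _ _ _ J (stirling_quot R) _ \oo); last exact: cvg_stirling_quot.
  move=> A [m _ hm]; apply: filterS (cvgry_ge Jy m%:R) => n.
  by rewrite ler_nat => h; apply: hm.
have c6 : Num.sqrt (x / x_ n) @[n --> \oo] --> (1 : R).
  rewrite -[X in _ --> X](@sqrtr1 R) -(@divff _ x) ?gt_eqF //.
  apply: continuous_cvg; first exact: sqrt_continuous.
  by apply: cvgM; [exact: cvg_cst|apply: cvgV => //; rewrite gt_eqF].
rewrite /asymp_equiv.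
(* Six factors tending to [1]: the first-kind coefficient, the second-kind weight, the normalising
   sum, Gauss's product at [c + r], Stirling's formula for [(J n)!], and the change from [x_ n] to
   [x] under the root. *)
apply: (@cvgn_ext _ (fun n => (coef_quot r n (J n) * Gamma (c * x + r)) *
   (stir2w k r (J n) / c ^+ J n) * (lahZ k r n / \prod_(i < n) (c + r + i%:R))^-1 *
   (gauss_quot (c + r) n * Gamma (c + r))^-1 *
   (Num.sqrt (2 * pi) / stirling_quot R (J n)) * Num.sqrt (x / x_ n))); last first.
  have E1 : 1 = ((Gamma (c * x + r))^-1 * Gamma (c * x + r)) * 1 * 1^-1 *
    ((Gamma (c + r))^-1 * Gamma (c + r))^-1 * (Num.sqrt (2 * pi) / Num.sqrt (2 * pi)) * 1 :> R.
    by field; rewrite !gt_eqF.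
  rewrite [X in _ --> X]E1.
  apply: cvgM => //; apply: cvgM; last first.
    by apply: cvgM; [exact: cvg_cst|apply: cvgV => //; rewrite gt_eqF].
  apply: cvgM; last first.
    apply: cvgV; first by rewrite mulVf ?gt_eqF ?oner_neq0.
    by apply: cvgM => //; exact: cvg_cst.
  apply: cvgM; last by apply: cvgV => //; exact: oner_neq0.
  by apply: cvgM => //; apply: cvgM => //; exact: cvg_cst.
near=> n.
have n1 : (1 < n)%N by near: n; exact: nbhs_infty_gt.
have nR : 0 < n%:R :> R by rewrite ltr0n ltnW.
have L0 : 0 < ln n%:R :> R by rewrite ln_gt0 // ltr1n.
have JE : (J n)%:R = c * x_ n * ln n%:R by near: n.
have xn0 : 0 < x_ n by near: n; exact: (cvgr_gt _ x_cvg).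
have J0 : (0 < J n)%N by near: n; exact: (near_J_gt cx_gt0 Jl).
have JR : 0 < (J n)%:R :> R by rewrite ltr0n.
have Z0 : 0 < lahZ k r n / \prod_(i < n) (c + r + i%:R) by near: n; exact: (cvgr_gt _ c3).
have P0 : 0 < \prod_(i < n) (c + r + i%:R) by apply: prodr_gt0 => i _; rewrite ltr_wpDr.
have {}Z0 : 0 < lahZ k r n by move: Z0; rewrite pmulr_lgt0 // invr_gt0.
rewrite lah_pmfE /coef_quot /gauss_quot /stirling_quot /normalizer.
have -> : Num.sqrt (2 * pi * c * x * ln n%:R) =
    Num.sqrt (2 * pi) * (Num.sqrt (J n)%:R * Num.sqrt (x / x_ n)).
  rewrite -sqrtrM ?(ltW JR) // -sqrtrM ?mulr_ge0 ?pi_ge0 //; congr Num.sqrt.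
  by rewrite JE; field; rewrite gt_eqF.
(* Since [J n = c x_n L], the quotient [(c L / J n) ^ J n] is [x_n ^ (- J n)]; together with
   [e^(J n)] and [n^(- c)] this is the stated power of [n]. *)
have -> : n%:R `^ (- (c * (x_ n * ln (x_ n) - x_ n + 1))) =
    (n%:R `^ c)^-1 * (c ^+ J n * ln n%:R ^+ J n / ((J n)%:R ^+ J n * expR (- (J n)%:R))).
  have -> : (J n)%:R ^+ J n = c ^+ J n * expR ((J n)%:R * ln (x_ n)) * ln n%:R ^+ J n.
    by rewrite expRM_natl lnK ?posrE // -!exprMn JE.
  have -> : expR (- (J n)%:R) = (expR (J n)%:R)^-1 :> R by rewrite expRN.
  have cJ0 : c ^+ J n != 0 by rewrite expf_eq0 gt_eqF // andbF.
  have LJ0 : ln n%:R ^+ J n != 0 :> R by rewrite expf_eq0 gt_eqF // andbF.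
  have -> : (n%:R `^ c)^-1 * (c ^+ J n * ln n%:R ^+ J n /
     (c ^+ J n * expR ((J n)%:R * ln (x_ n)) * ln n%:R ^+ J n * (expR (J n)%:R)^-1)) =
     (n%:R `^ c)^-1 * ((expR ((J n)%:R * ln (x_ n)))^-1 * expR (J n)%:R).
    by field; rewrite cJ0 LJ0 !expR_eq0 gt_eqF ?powR_gt0.
  rewrite -expRN -powRN /powR gt_eqF // -!expRD JE; congr expR; ring.
have -> : n%:R `^ (c + r - 1) = n%:R `^ (r - 1) * n%:R `^ c :> R.
  by rewrite -powRD ?(gt_eqF nR) ?implybT //; congr powR; ring.
have sJ : 0 < Num.sqrt (J n)%:R :> R by rewrite sqrtr_gt0.
have sx : 0 < Num.sqrt (x / x_ n) :> R by rewrite sqrtr_gt0 divr_gt0.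
have p1 : 0 < n%:R `^ (r - 1) :> R by rewrite powR_gt0.
have p2 : 0 < n%:R `^ c :> R by rewrite powR_gt0.
have f1 : 0 < n`!%:R :> R by rewrite ltr0n fact_gt0.
have f2 : 0 < (J n)`!%:R :> R by rewrite ltr0n fact_gt0.
have q1 : 0 < c ^+ J n by rewrite exprn_gt0.
have q2 : 0 < ln n%:R ^+ J n :> R by rewrite exprn_gt0.
have q3 : 0 < (J n)%:R ^+ J n :> R by rewrite exprn_gt0.
have q4 : 0 < expR (- (J n)%:R) :> R by exact: expR_gt0.
move: q1 q2 q3 q4 f1 f2 p1 p2 sJ sx s2p G1 G2 Z0 P0.
move: (c ^+ J n) (ln n%:R ^+ J n) ((J n)%:R ^+ J n) (expR (- (J n)%:R)) (n`!%:R : R) ((J n)`!%:R : R).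
move=> u1 u2 u3 u4 u5 u6.
move: (n%:R `^ (r - 1)) (n%:R `^ c) (Num.sqrt (J n)%:R) (Num.sqrt (x / x_ n)) (Num.sqrt (2 * pi)).
move=> u7 u8 u9 u10 u11.
move: (Gamma (c * x + r)) (Gamma (c + r)) (lahZ k r n) (\prod_(i < n) _) (stir2w _ _ _) ((rising n r)`_(J n)).
move=> u12 u13 u14 u15 u16 u17 *.
by field; rewrite !gt_eqF.
Unshelve. all: by end_near. Qed.

End pmf_asymptotics.

(** * From the prescribed point masses to probabilities of events *)

Section lah_probability.
Variables (R : realType) (k n : nat) (r : R).
Variables (d : measure_display) (T : measurableType d) (P : probability T R).
Variable X : {RV P >-> R}.
Hypothesis XP : rLah_distributed n k r X.
Hypothesis kn : (k <= n)%N.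
Hypothesis rlah_neq0 : rlah n k r != 0.

Let I u v := [set w | exists2 j, (u <= j < v)%N & X w = j%:R].

Let measurable_eq (t : R) : measurable [set w | X w = t].
Proof.
by rewrite (_ : [set w | X w = t] = X @^-1` [set t]) //.
Qed.

Let I_succ u v : (u <= v)%N -> I u v.+1 = I u v `|` [set w | X w = v%:R].
Proof.
move=> uv; apply/seteqP; split => w.
  move=> [j /andP[uj]]; rewrite ltnS leq_eqVlt => /predU1P[->|jv] Xw; first by right.
  by left; exists j => //; rewrite uj.
move=> [[j /andP[uj jv] Xw]|Xw]; first by exists j => //; rewrite uj ltnW.
by exists v => //; rewrite uv /=.
Qed.

Let I_ge u v : (v <= u)%N -> I u v = set0.
Proof. by move=> vu; apply/seteqP; split => // w [j /andP[]]; lia. Qed.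

Let measurable_I u v : measurable (I u v).
Proof.
elim: v => [|v IH]; first by rewrite I_ge.
case: (leqP u v) => uv; last by rewrite I_ge.
by rewrite I_succ //; exact: measurableU.
Qed.

Let prob_I u v : (k <= u)%N -> (v <= n.+1)%N ->
  P (I u v) = (\sum_(u <= j < v) lah_pmf k r n j)%:E.
Proof.
move=> ku; elim: v => [|v IH] vn.
  by rewrite I_ge // big_geq // measure0.
case: (leqP u v) => uv; last by rewrite I_ge // big_geq // measure0.
transitivity (P (I u v) + P [set w | X w = v%:R])%E.
  rewrite I_succ // measureU //.
  apply/seteqP; split => // w [[j /andP[_ jv] Xj] /=]; rewrite Xj => /eqP.
  by rewrite eqr_nat => /eqP e; move: jv; rewrite e ltnn.
rewrite IH ?(ltnW vn) // XP; last by rewrite (leq_trans ku uv).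
by rewrite big_nat_recr //= EFinD.
Qed.

(** The law is prescribed only at [k, ..., n]. These masses sum to [1], so all other values form a
    null event and [E] has to be described at these points only. *)
Lemma prob_lah_itv (E : set T) u v : measurable E -> (k <= u)%N -> (v <= n.+1)%N ->
  (forall w j, (k <= j <= n)%N -> X w = j%:R -> E w <-> (u <= j < v)%N) ->
  fine (P E) = \sum_(u <= j < v) lah_pmf k r n j.
Proof.
move=> mE ku vn EP.
have total : P (~` I k n.+1) = 0%E.
  rewrite probability_setC // prob_I // (_ : \sum_(_ <= _ < _) _ = 1) ?subee //.
  by rewrite /lah_pmf -mulr_sumr mulVf.
suff -> : P E = P (I u v) by rewrite prob_I.
apply/eqP; rewrite eq_le; apply/andP; split; last first.
  apply: le_measure; rewrite ?inE //.
  move=> w [j /andP[uj jv] Xw]; apply/(EP w j) => //; last by rewrite uj.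
  by rewrite (leq_trans ku uj) -ltnS (leq_trans jv).
have -> : P (I u v) = (P (I u v) + P (~` I k n.+1))%E by rewrite total adde0.
apply: (le_trans _ (measureU2 _ _ _)); [|by []|exact: measurableC].
apply: le_measure; rewrite ?inE //.
  by apply: measurableU => //; exact: measurableC.
move=> w Ew; have [[j kj Xw]|nI] := pselect (I k n.+1 w); last by right.
left; exists j => //; apply/(EP w j) => //.
Qed.

End lah_probability.

Theorem theorem3p22 (R : realType) (k : nat) (r : R)
    (r_ge0 : 0 <= r) (kr_gt0 : 0 < Num.max k%:R r)
    (d : nat -> measure_display) (T : forall n : nat, measurableType (d n))
    (P : forall n : nat, probability (T n) R)
    (Lah : forall n : nat, {RV (P n) >-> R})
    (LahP : forall n : nat, (0 < n)%N -> (k <= n)%N ->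
       rLah_distributed n k r (Lah n))
    (x_ : nat -> R) (x : R) (x_gt0 : 0 < x)
    (x_cvg : x_ n @[n --> \oo] --> x)
    (x_int : forall n : nat, (0 < n)%N ->
       (k%:R + r) * x_ n * ln n%:R \is a Num.int) :
  [/\ asymp_equiv
        (fun n => fine (P n [set w | Lah n w = (k%:R + r) * x_ n * ln n%:R]))
        (fun n =>
           n%:R `^ (- ((k%:R + r) * (x_ n * ln (x_ n) - x_ n + 1)))
             / Num.sqrt (2 * pi * (k%:R + r) * x * ln n%:R)
           * (Gamma (k%:R + 2 * r) / Gamma ((k%:R + r) * x + r))),
      1 < x -> asymp_equiv
        (fun n => fine (P n [set w | Lah n w >= (k%:R + r) * x_ n * ln n%:R]))
        (fun n =>
           x / (x - 1)
           * (n%:R `^ (- ((k%:R + r) * (x_ n * ln (x_ n) - x_ n + 1)))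
                / Num.sqrt (2 * pi * (k%:R + r) * x * ln n%:R))
           * (Gamma (k%:R + 2 * r) / Gamma ((k%:R + r) * x + r)))
    & x < 1 -> asymp_equiv
        (fun n => fine (P n [set w | Lah n w <= (k%:R + r) * x_ n * ln n%:R]))
        (fun n =>
           1 / (1 - x)
           * (n%:R `^ (- ((k%:R + r) * (x_ n * ln (x_ n) - x_ n + 1)))
                / Num.sqrt (2 * pi * (k%:R + r) * x * ln n%:R))
           * (Gamma (k%:R + 2 * r) / Gamma ((k%:R + r) * x + r)))].
Proof.
have c_gt0 : 0 < k%:R + r.
  move: kr_gt0; rewrite lt_max => /orP[k0|r0]; first by rewrite ltr_wpDr.
  by rewrite ltr_wpDl.
set c := k%:R + r in c_gt0 x_int *.
(* For small [n] the prescribed integer may be negative; the truncation equals it once [x_ n] is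
   nonnegative. *)
pose J n := Num.truncn (c * x_ n * ln n%:R).
have JE : \forall n \near \oo, (J n)%:R = c * x_ n * ln n%:R.
  near=> n; apply: truncnK; rewrite natrEint x_int ?andTb.
    rewrite !mulr_ge0 ?(ltW c_gt0) // ?ln_ge0 ?ler1n //.
    - by near: n; apply: (cvgr_ge _ x_cvg).
    - by near: n; exact: nbhs_infty_gt.
  by near: n; exact: nbhs_infty_gt.
have Jl := cvg_J_div_ln x_cvg JE.
have cx_gt0 : 0 < c * x by rewrite mulr_gt0.
have main := cvg_lah_pmf r_ge0 c_gt0 x_gt0 x_cvg JE.
have pmf_gt0 : \forall n \near \oo, 0 < lah_pmf k r n (J n).
  near=> n; rewrite lah_pmfE divr_gt0 //.
    by near: n; exact: (near_term_gt0 r_ge0 c_gt0 x_gt0 Jl).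
  have : 0 < lahZ k r n / \prod_(i < n) (c + r + i%:R).
    by near: n; exact: (cvgr_gt _ (cvg_lahZ r_ge0 c_gt0)).
  rewrite pmulr_lgt0 // invr_gt0; apply: prodr_gt0 => i _.
  by rewrite ltr_wpDr // ltr_wpDr.
have basic : \forall n \near \oo, [/\ (0 < n)%N, (k <= J n)%N, (J n <= n)%N, (k <= n)%N & rlah n k r != 0].
  near=> n.
  have kJ : (k < J n)%N by near: n; exact: near_J_gt cx_gt0 Jl _.
  have Jn : (J n + 0 < n)%N by near: n; exact: near_J_lt Jl _.
  have p0 : 0 < lah_pmf k r n (J n) by near: n.
  split; try lia.
  (* Were [rlah n k r] zero, its inverse would be [0] by convention and the mass at [J n] would
     vanish. *)
  by apply: contraTneq p0 => h; rewrite /lah_pmf h invr0 mul0r ltxx.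
set tgt := fun n => n%:R `^ _ / _ * _ in main.
(* Reduces both tails to the point mass: a limit relative to the mass at [J n] combines with
   [main]. *)
have tail (u : nat -> R) (q : R) : q != 0 -> u n / lah_pmf k r n (J n) @[n --> \oo] --> q ->
    asymp_equiv u (fun n => q * tgt n).
  move=> q0 uq; rewrite /asymp_equiv.
  apply: (@cvgn_ext _ (fun n => u n / lah_pmf k r n (J n) * (lah_pmf k r n (J n) / tgt n) * q^-1)); last first.
    rewrite [X in _ --> X](_ : 1 = q * 1 * q^-1); last by rewrite mulr1 divff.
    by apply: cvgM; [exact: cvgM|exact: cvg_cst].
  near=> n; have p0 : 0 < lah_pmf k r n (J n) by near: n.
  by move: (tgt n) p0 => t p0; rewrite mulrA divfK ?gt_eqF // [(q * t)^-1]invfM; ring.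
have mle n (t : R) : measurable [set w | Lah n w <= t].
  have -> : [set w | Lah n w <= t] = Lah n @^-1` `]-oo, t]%classic.
    by apply/seteqP; split => w /=; rewrite in_itv.
  by rewrite -[X in measurable X]setTI; apply: measurable_funP => //; exact: measurable_itv.
have mge n (t : R) : measurable [set w | t <= Lah n w].
  have -> : [set w | t <= Lah n w] = Lah n @^-1` `[t, +oo[%classic.
    by apply/seteqP; split => w /=; rewrite in_itv /= andbT.
  by rewrite -[X in measurable X]setTI; apply: measurable_funP => //; exact: measurable_itv.
split.
- rewrite /asymp_equiv; apply: cvgn_ext main; near=> n.
  have JEn : (J n)%:R = c * x_ n * ln n%:R by near: n.
  have [n0 kJ Jn kn Z0] : [/\ (0 < n)%N, (k <= J n)%N, (J n <= n)%N, (k <= n)%N & rlah n k r != 0] by near: n.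
  by rewrite -JEn (LahP n n0 kn) // kJ Jn.
- move=> x1; have q0 : x / (x - 1) != 0 by rewrite mulf_neq0 ?invr_neq0 ?gt_eqF // subr_gt0.
  have := tail _ _ q0 (cvg_upper_tail r_ge0 c_gt0 x_gt0 Jl x1).
  rewrite /asymp_equiv; apply: cvg_trans; apply: near_eq_cvg; near=> n.
  have JEn : (J n)%:R = c * x_ n * ln n%:R by near: n.
  have [n0 kJ Jn kn Z0] : [/\ (0 < n)%N, (k <= J n)%N, (J n <= n)%N, (k <= n)%N & rlah n k r != 0] by near: n.
  rewrite -JEn (prob_lah_itv (LahP n n0 kn) kn Z0 (u := J n) (v := n.+1)) //.
    by rewrite /tgt !mulrA.
  by move=> w j /andP[_ jn] /= ->; rewrite ler_nat ltnS jn andbT.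
- move=> x1; have q0 : 1 / (1 - x) != 0 by rewrite mulf_neq0 ?invr_neq0 ?gt_eqF // subr_gt0.
  have := tail _ _ q0 (cvg_lower_tail r_ge0 c_gt0 x_gt0 Jl x1).
  rewrite /asymp_equiv; apply: cvg_trans; apply: near_eq_cvg; near=> n.
  have JEn : (J n)%:R = c * x_ n * ln n%:R by near: n.
  have [n0 kJ Jn kn Z0] : [/\ (0 < n)%N, (k <= J n)%N, (J n <= n)%N, (k <= n)%N & rlah n k r != 0] by near: n.
  rewrite -JEn (prob_lah_itv (LahP n n0 kn) kn Z0 (u := k) (v := (J n).+1)) //.
    by rewrite /tgt !mulrA.
  by move=> w j /andP[kj _] /= ->; rewrite ler_nat ltnS kj.
Unshelve. all: by end_near. Qed.
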